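(* Let $S$ be a self-adjoint subspace in $X^2$ and $A$ a closed Hermitian subspace in $X^2$ with $D(S)\subset D(A)$. If $A_s$ is $S_s$-compact, then $\sigma_e(S)=\sigma_e(S+A)$; consequently $\sigma_e(S)=\emptyset$ if and only if $\sigma_e(S+A)=\emptyset$.
   Context: $X$ is a complex Hilbert space and $X^2=X\times X$ carries the inner product $\langle (x,f),(y,g)\rangle=\langle x,y\rangle+\langle f,g\rangle$. A subspace $T$ in $X^2$ means a linear subspace of $X^2$ (a linear relation); a linear operator in $X$ is identified with its graph. Notation: $D(T)=\{x:(x,f)\in T \text{ for some } f\}$, $T(x)=\{f:(x,f)\in T\}$, $T^{-1}=\{(f,x):(x,f)\in T\}$, $\lambda I$ is the graph of $x\mapsto\lambda x$. The adjoint is $T^*=\{(y,g)\in X^2:\langle g,x\rangle=\langle y,f\rangle \text{ for all }(x,f)\in T\}$; $T$ is Hermitian if $T\subset T^*$ and self-adjoint if $T=T^*$. For subspaces $S,A$ in $X^2$, $S+A=\{(x,f+g):(x,f)\in S,(x,g)\in A\}$. For a closed subspace $T$, set $T_\infty=\{(0,g)\in X^2:(0,g)\in T\}$ and $T_s=T\ominus T_\infty$ (orthogonal complement of $T_\infty$ in $T$), so $T=T_s\oplus T_\infty$; $T_s$ is the graph of a linear operator (the operator part of $T$) with $D(T_s)=D(T)$ and $R(T_s)\subset T(0)^\perp$. For linear operators $U,V$ in $X$ with $D(V)\subset D(U)$: $U$ is $V$-compact if $U|_{D(V)}$ is compact as a map from $(D(V),\|\cdot\|_V)$ into $X$, where $\|x\|_V=\|x\|+\|Vx\|$.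 Resolvent set: $\rho(T)=\{\lambda\in\mathbb C:(\lambda I-T)^{-1}$ is a bounded linear operator defined on all of $X\}$; spectrum $\sigma(T)=\mathbb C\setminus\rho(T)$. A number $\lambda$ is an eigenvalue of $T$ if $(x,\lambda x)\in T$ for some $x\ne 0$, with multiplicity the dimension of $\{x:(x,\lambda x)\in T\}$. The essential spectrum $\sigma_e(T)$ is the set of points of $\sigma(T)$ that are either accumulation points of $\sigma(T)$ or isolated eigenvalues of infinite multiplicity. *)

(* Defs.v *)
From Stdlib Require Import Reals.
Open Scope R_scope.

Record Cx := mkC { Re : R; Im : R }.
Definition C0 : Cx := mkC 0 0.
Definition C1 : Cx := mkC 1 0.
Definition Cadd (z w : Cx) : Cx := mkC (Re z + Re w) (Im z + Im w).
Definition Copp (z : Cx) : Cx := mkC (- Re z) (- Im z).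
Definition Csub (z w : Cx) : Cx := Cadd z (Copp w).
Definition Cmul (z w : Cx) : Cx :=
  mkC (Re z * Re w - Im z * Im w) (Re z * Im w + Im z * Re w).
Definition Cconj (z : Cx) : Cx := mkC (Re z) (- Im z).
Definition Cmod (z : Cx) : R := sqrt (Re z * Re z + Im z * Im z).

Record HilbertSpace := {
  carrier :> Type;
  vzero : carrier;
  vadd : carrier -> carrier -> carrier;
  vopp : carrier -> carrier;
  vscal : Cx -> carrier -> carrier;
  inner : carrier -> carrier -> Cx;
  vadd_comm : forall x y, vadd x y = vadd y x;
  vadd_assoc : forall x y z, vadd x (vadd y z) = vadd (vadd x y) z;
  vadd_zero : forall x, vadd x vzero = x;
  vadd_opp : forall x, vadd x (vopp x) = vzero;
  vscal_one : forall x, vscal C1 x = x;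
  vscal_assoc : forall a b x, vscal a (vscal b x) = vscal (Cmul a b) x;
  vscal_distr_v : forall a x y, vscal a (vadd x y) = vadd (vscal a x) (vscal a y);
  vscal_distr_s : forall a b x, vscal (Cadd a b) x = vadd (vscal a x) (vscal b x);
  inner_add_l : forall x y z, inner (vadd x y) z = Cadd (inner x z) (inner y z);
  inner_scal_l : forall a x y, inner (vscal a x) y = Cmul a (inner x y);
  inner_conj : forall x y, inner y x = Cconj (inner x y);
  inner_pos : forall x, 0 <= Re (inner x x);
  inner_def : forall x, inner x x = C0 -> x = vzero;
  complete : forall u : nat -> carrier,
    (forall eps, 0 < eps -> exists N, forall n m, (N <= n)%nat -> (N <= m)%nat ->
        sqrt (Re (inner (vadd (u n) (vopp (u m))) (vadd (u n) (vopp (u m))))) < eps) ->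
    exists l, forall eps, 0 < eps -> exists N, forall n, (N <= n)%nat ->
        sqrt (Re (inner (vadd (u n) (vopp l)) (vadd (u n) (vopp l)))) < eps
}.

Arguments vzero {h}.
Arguments vadd {h}.
Arguments vopp {h}.
Arguments vscal {h}.
Arguments inner {h}.

Section Defs.
Variable X : HilbertSpace.

Definition vsub (x y : X) : X := vadd x (vopp y).
Definition norm (x : X) : R := sqrt (Re (inner x x)).

Definition converges (u : nat -> X) (l : X) : Prop :=
  forall eps, 0 < eps -> exists N, forall n, (N <= n)%nat -> norm (vsub (u n) l) < eps.

Fixpoint lin_comb (c : nat -> Cx) (v : nat -> X) (n : nat) : X :=
  match n with
  | O => vzero
  | S k => vadd (lin_comb c v k) (vscal (c k) (v k))
  end.

Definition rel := X -> X -> Prop.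

Definition is_subspace (T : rel) : Prop :=
  T vzero vzero /\
  (forall x f y g, T x f -> T y g -> T (vadd x y) (vadd f g)) /\
  (forall a x f, T x f -> T (vscal a x) (vscal a f)).

Definition inner2 (x f y g : X) : Cx := Cadd (inner x y) (inner f g).

(** closed subspace: closed in the norm topology of X^2 (equivalently,
    closed under componentwise limits) *)
Definition rel_closed (T : rel) : Prop :=
  forall (x f : nat -> X) (x0 f0 : X),
    (forall n, T (x n) (f n)) -> converges x x0 -> converges f f0 -> T x0 f0.

Definition dom (T : rel) (x : X) : Prop := exists f, T x f.

Definition rel_inv (T : rel) : rel := fun f x => T x f.

Definition lamI (l : Cx) : rel := fun x y => y = vscal l x.

Definition rel_sum (S A : rel) : rel :=
  fun x h => exists f g, S x f /\ A x g /\ h = vadd f g.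

Definition rel_opp (T : rel) : rel := fun x f => T x (vopp f).

Definition adjoint (T : rel) : rel :=
  fun y g => forall x f, T x f -> inner g x = inner y f.

Definition hermitian (T : rel) : Prop := forall x f, T x f -> adjoint T x f.
Definition selfadjoint (T : rel) : Prop := forall x f, T x f <-> adjoint T x f.

(** T_infinity and the operator part T_s = T minus T_infinity *)
Definition rel_inf (T : rel) : rel := fun x g => x = vzero /\ T vzero g.
Definition rel_s (T : rel) : rel :=
  fun x f => T x f /\ forall y g, rel_inf T y g -> inner2 x f y g = C0.

(** U is V-compact (U, V graphs of linear operators): D(V) ⊂ D(U) and
    U restricted to D(V) maps ||.||_V-bounded sequences to sequences having
    a convergent subsequence. *)
Definition rel_compact_wrt (U V : rel) : Prop :=
  (forall x, dom V x -> dom U x) /\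
  forall (x v u : nat -> X) (M : R),
    (forall n, V (x n) (v n)) -> (forall n, U (x n) (u n)) ->
    (forall n, norm (x n) + norm (v n) <= M) ->
    exists (phi : nat -> nat) (l : X),
      (forall n, (phi n < phi (S n))%nat) /\ converges (fun n => u (phi n)) l.

Definition bounded_everywhere_op (Rl : rel) : Prop :=
  is_subspace Rl /\
  (forall y x1 x2, Rl y x1 -> Rl y x2 -> x1 = x2) /\
  (forall y, exists x, Rl y x) /\
  (exists M, forall y x, Rl y x -> norm x <= M * norm y).

Definition resolvent (T : rel) (l : Cx) : Prop :=
  bounded_everywhere_op (rel_inv (rel_sum (lamI l) (rel_opp T))).

Definition spectrum (T : rel) (l : Cx) : Prop := ~ resolvent T l.

Definition eigenvalue (T : rel) (l : Cx) : Prop :=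
  exists x, x <> vzero /\ T x (vscal l x).

Definition infinite_multiplicity (T : rel) (l : Cx) : Prop :=
  forall n : nat, exists v : nat -> X,
    (forall i, (i < n)%nat -> T (v i) (vscal l (v i))) /\
    (forall c : nat -> Cx, lin_comb c v n = vzero -> forall i, (i < n)%nat -> c i = C0).

Definition accumulation_point (P : Cx -> Prop) (l : Cx) : Prop :=
  forall eps, 0 < eps -> exists m, P m /\ m <> l /\ Cmod (Csub m l) < eps.

Definition ess_spectrum (T : rel) (l : Cx) : Prop :=
  spectrum T l /\
  (accumulation_point (spectrum T) l \/
   (eigenvalue T l /\ ~ accumulation_point (spectrum T) l /\
    infinite_multiplicity T l)).

End Defs.

(* Main.v *)
(** Write [G = A_s]. Hermiticity of [A] and [D(S) ⊂ D(A)] force [A(0) ⊂ S(0)],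
    so [S + A = S + G]. Relative compactness and closedness give [G] relative
    [S]-bound [0], hence [T = S + G] is self-adjoint: for large [mu] the range
    of [T - i mu] is closed and has trivial orthogonal complement.

    For self-adjoint [T], [l] lies outside the essential spectrum iff every
    bounded sequence [x_n] with [(T - l) x_n] convergent has a limit point
    ([proper_at]). If [l] is isolated in the spectrum, or regular, then [T - l]
    is bounded below on the orthogonal complement of its kernel; conversely,
    spectral points accumulating at [l] provide almost orthogonal approximate
    eigenvectors. The spectral gap is obtained without functional calculus, by
    elementary quadratic inequalities.

    Being proper passes from [S] to [T] and back, since [G] maps sequences
    bounded in either graph norm to sequences with a limit point. *)

(* [S] and [T] may be multivalued with non-dense domains, whereas compactness is assumed only
   between operator parts. Two devices bridge this. For [(x, f)] in [S] the operator part of [f] has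
   norm at most [|f|], so bounds on arbitrary values of [S] control the graph norm of [S_s].
   Self-adjointness is used as maximality: a pair that is symmetric against every element of [T]
   belongs to [T], which makes sense without density.

   Limit points are used in place of weakly null singular sequences because they survive the
   addition of any sequence having a limit point. The way back from [T] to [S] needs a bound on
   [(T - G) x]; a relative bound below 1 provides it.

   The obstacle in the gap estimate is that 0 may itself be spectral, so [T] cannot be inverted. The
   regular intervals on the two sides of 0 give one form inequality each, and these combine only on
   the range of [T]; the closure of the range is the complement of the kernel. *)
From Stdlib Require Import Reals Lra Lia List Classical ClassicalEpsilon.
Require Import Defs.

Arguments vsub {X}.
Arguments norm {X}.
Arguments converges {X}.

(* [X] is treated as a real Hilbert space, with [J] (multiplication by [i]) carrying
   the complex structure; [Im <x, y>] is [ri x (J y)]. *)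
Definition ri {X : HilbertSpace} (x y : X) : R := Re (inner x y).
Definition rs {X : HilbertSpace} (t : R) (x : X) : X := vscal (mkC t 0) x.
Definition J {X : HilbertSpace} (x : X) : X := vscal (mkC 0 1) x.

Local Infix "[+]" := vadd (at level 50, left associativity).
Local Infix "[-]" := vsub (at level 50, left associativity).
Local Infix "[*]" := rs (at level 40, left associativity).

(** * The real inner product and multiplication by the imaginary unit *)

Section HilbertGeometry.
Context {X : HilbertSpace}.
Implicit Types x y z u v w : X.

Lemma Cx_eq (z w : Cx) : Re z = Re w -> Im z = Im w -> z = w.
Proof. destruct z, w; simpl; intros -> ->; reflexivity. Qed.

Lemma ri_sym x y : ri x y = ri y x.
Proof. unfold ri; rewrite (inner_conj _ x y); reflexivity. Qed.

Lemma ri_add_l x y z : ri (x [+] y) z = ri x z + ri y z.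
Proof. unfold ri; rewrite inner_add_l; reflexivity. Qed.

Lemma ri_add_r x y z : ri z (x [+] y) = ri z x + ri z y.
Proof. rewrite !(ri_sym z); apply ri_add_l. Qed.

Lemma ri_zero_l z : ri vzero z = 0.
Proof.
  pose proof (ri_add_l vzero vzero z) as H; rewrite vadd_zero in H; lra.
Qed.

Lemma ri_zero_r z : ri z vzero = 0.
Proof. rewrite ri_sym; apply ri_zero_l. Qed.

Lemma ri_opp_l x z : ri (vopp x) z = - ri x z.
Proof.
  pose proof (ri_add_l x (vopp x) z) as H; rewrite vadd_opp, ri_zero_l in H; lra.
Qed.

Lemma ri_opp_r x z : ri z (vopp x) = - ri z x.
Proof. rewrite !(ri_sym z); apply ri_opp_l. Qed.

Lemma ri_sub_l x y z : ri (x [-] y) z = ri x z - ri y z.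
Proof. unfold vsub; rewrite ri_add_l, ri_opp_l; ring. Qed.

Lemma ri_sub_r x y z : ri z (x [-] y) = ri z x - ri z y.
Proof. rewrite !(ri_sym z); apply ri_sub_l. Qed.

Lemma ri_rs_l t x z : ri (t [*] x) z = t * ri x z.
Proof. unfold ri, rs; rewrite inner_scal_l; simpl; ring. Qed.

Lemma ri_rs_r t x z : ri z (t [*] x) = t * ri z x.
Proof. rewrite !(ri_sym z); apply ri_rs_l. Qed.

Lemma ri_J_r x y : ri x (J y) = Im (inner x y).
Proof.
  unfold ri, J; rewrite (inner_conj _ (vscal _ y) x), inner_scal_l.
  rewrite (inner_conj _ x y); simpl; ring.
Qed.

Lemma ri_J_l x y : ri (J x) y = - ri x (J y).
Proof. rewrite ri_J_r; unfold ri, J; rewrite inner_scal_l; simpl; ring. Qed.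

Lemma ri_JJ x y : ri x (J (J y)) = - ri x y.
Proof.
  rewrite ri_J_r, (inner_conj _ (J y) x); unfold J; rewrite inner_scal_l.
  rewrite (inner_conj _ x y); unfold ri; simpl; ring.
Qed.

Lemma ri_vscal_l (l : Cx) x z : ri (vscal l x) z = Re l * ri x z - Im l * ri x (J z).
Proof. rewrite ri_J_r; unfold ri; rewrite inner_scal_l; reflexivity. Qed.

Lemma ri_self_J x : ri x (J x) = 0.
Proof. pose proof (ri_sym x (J x)) as H; rewrite ri_J_l in H; lra. Qed.

Lemma ri_pos x : 0 <= ri x x.
Proof. apply inner_pos. Qed.

Lemma ri_def x : ri x x = 0 -> x = vzero.
Proof.
  intros H; apply inner_def, Cx_eq; simpl; [exact H|].
  rewrite <- ri_J_r; apply ri_self_J.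
Qed.

Lemma vadd_opp_eq x y : x [+] vopp y = vzero -> x = y.
Proof.
  intros H; rewrite <- (vadd_zero _ x), <- (vadd_opp _ y), (vadd_comm _ y).
  rewrite vadd_assoc, H, vadd_comm; apply vadd_zero.
Qed.

(* Vector identities are checked by pairing both sides with a test vector. *)
Lemma vext x y : (forall z, ri x z = ri y z) -> x = y.
Proof.
  intros H; apply vadd_opp_eq, ri_def.
  rewrite ri_add_l, ri_opp_l, H; ring.
Qed.

Lemma inner_ri x y : inner x y = mkC (ri x y) (ri x (J y)).
Proof. apply Cx_eq; simpl; [reflexivity|symmetry; apply ri_J_r]. Qed.

End HilbertGeometry.

#[local] Hint Rewrite @ri_add_l @ri_opp_l @ri_sub_l @ri_rs_l @ri_zero_l @ri_J_l
  @ri_vscal_l @ri_JJ : ri_left.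
#[local] Hint Rewrite @ri_add_l @ri_opp_l @ri_sub_l @ri_rs_l @ri_zero_l
  @ri_add_r @ri_opp_r @ri_sub_r @ri_rs_r @ri_zero_r : ri_both.

Ltac vec := apply vext; intro; autorewrite with ri_left; simpl; try ring.

(** * The norm, Cauchy-Schwarz and triangle inequalities *)

Section Norm.
Context {X : HilbertSpace}.
Implicit Types x y z u v w : X.

Lemma norm_ge0 x : 0 <= norm x.
Proof. apply sqrt_pos. Qed.

Lemma norm_sqr x : norm x * norm x = ri x x.
Proof. apply sqrt_sqrt, ri_pos. Qed.

Lemma norm_le x a : 0 <= a -> ri x x <= a * a -> norm x <= a.
Proof. pose proof (norm_ge0 x); pose proof (norm_sqr x); nra. Qed.

Lemma norm_ge x a : a * a <= ri x x -> a <= norm x.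
Proof. pose proof (norm_ge0 x); pose proof (norm_sqr x); nra. Qed.

Lemma norm_eq x y : ri x x = ri y y -> norm x = norm y.
Proof. intros H; unfold norm; unfold ri in H; rewrite H; reflexivity. Qed.

Lemma norm_zero : norm (vzero : X) = 0.
Proof. pose proof (norm_sqr vzero) as H; rewrite ri_zero_l in H; nra. Qed.

Lemma norm_eq0 x : norm x <= 0 -> x = vzero.
Proof.
  intros H; apply ri_def; pose proof (norm_ge0 x); rewrite <- norm_sqr; nra.
Qed.

Lemma norm_opp x : norm (vopp x) = norm x.
Proof. apply norm_eq; autorewrite with ri_both; ring. Qed.

Lemma norm_sub_sym x y : norm (x [-] y) = norm (y [-] x).
Proof. apply norm_eq; autorewrite with ri_both; ring. Qed.

Lemma norm_J x : norm (J x) = norm x.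
Proof. apply norm_eq; rewrite ri_J_l, ri_JJ; ring. Qed.

Lemma norm_rs t x : norm (t [*] x) = Rabs t * norm x.
Proof.
  pose proof (norm_ge0 x); pose proof (norm_ge0 (t [*] x)); pose proof (Rabs_pos t).
  apply Rsqr_inj; [assumption|nra|]; rewrite Rsqr_mult, <- Rsqr_abs; unfold Rsqr.
  rewrite !norm_sqr; autorewrite with ri_both; ring.
Qed.

Lemma cauchy_schwarz x y : Rabs (ri x y) <= norm x * norm y.
Proof.
  pose proof (norm_ge0 x); pose proof (norm_ge0 y).
  pose proof (norm_sqr x) as Hx; pose proof (norm_sqr y) as Hy.
  destruct (Req_dec (norm y) 0) as [E|E].
  - rewrite (norm_eq0 y) by lra; rewrite ri_zero_r, Rabs_R0, norm_zero; lra.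
  (* The component of [x] orthogonal to [y], scaled by [|y|^2] to avoid a division; cancelling
     [|y|^2] in its squared norm gives the inequality. *)
  - pose proof (ri_pos ((norm y * norm y) [*] x [-] (ri x y) [*] y)) as H1.
    autorewrite with ri_both in H1; rewrite (ri_sym y x) in H1.
    rewrite <- Hx, <- Hy in H1.
    assert (0 < norm y * norm y) by nra.
    assert (H4 : 0 <= (norm y * norm y) * ((norm x * norm y)^2 - (ri x y)^2))
      by (eapply Rle_trans; [exact H1|right; ring]).
    assert (H3 : 0 <= (norm x * norm y)^2 - (ri x y)^2).
    { apply Rmult_le_reg_l with (norm y * norm y); lra. }
    assert (0 <= norm x * norm y) by nra; apply Rabs_le; split; nra.
Qed.

Lemma ri_le x y : ri x y <= norm x * norm y.
Proof. eapply Rle_trans; [apply Rle_abs|apply cauchy_schwarz]. Qed.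

Lemma norm_triangle x y : norm (x [+] y) <= norm x + norm y.
Proof.
  pose proof (norm_ge0 x); pose proof (norm_ge0 y).
  apply norm_le; [lra|]; autorewrite with ri_both.
  pose proof (ri_le x y); rewrite (ri_sym y x).
  pose proof (norm_sqr x); pose proof (norm_sqr y); nra.
Qed.

Lemma norm_sub_le x y : norm (x [-] y) <= norm x + norm y.
Proof. unfold vsub; rewrite <- (norm_opp y); apply norm_triangle. Qed.

Lemma norm_triangle3 x y z : norm (x [-] z) <= norm (x [-] y) + norm (y [-] z).
Proof.
  replace (x [-] z) with ((x [-] y) [+] (y [-] z)) by vec; apply norm_triangle.
Qed.

Lemma norm_le_sub x y : norm x <= norm (x [-] y) + norm y.
Proof.
  replace (norm x) with (norm ((x [-] y) [+] y)) by (f_equal; vec).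
  apply norm_triangle.
Qed.

Lemma norm_vscal_le (l : Cx) x : norm (vscal l x) <= (Rabs (Re l) + Rabs (Im l)) * norm x.
Proof.
  replace (vscal l x) with (Re l [*] x [+] Im l [*] J x) by vec.
  eapply Rle_trans; [apply norm_triangle|].
  rewrite !norm_rs, norm_J; lra.
Qed.

End Norm.

(** * Subsequences, convergence and limit points *)

Definition subseq (phi : nat -> nat) : Prop := forall n, (phi n < phi (S n))%nat.

Lemma subseq_ge phi : subseq phi -> forall n, (n <= phi n)%nat.
Proof. intros H n; induction n; [lia|]; specialize (H n); lia. Qed.

Lemma subseq_lt phi : subseq phi -> forall n m, (n < m)%nat -> (phi n < phi m)%nat.
Proof.
  intros H n m Hm; induction Hm; [apply H|]; specialize (H m); lia.
Qed.

Lemma subseq_comp phi psi : subseq phi -> subseq psi -> subseq (fun n => phi (psi n)).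
Proof. intros H1 H2 n; apply subseq_lt; [exact H1|apply H2]. Qed.

Section Limits.
Context {X : HilbertSpace}.
Implicit Types x y z : X.
Implicit Types u v : nat -> X.

Definition cauchy u : Prop := forall eps, 0 < eps -> exists N, forall n m,
  (N <= n)%nat -> (N <= m)%nat -> norm (u n [-] u m) < eps.

Definition has_limit_point u : Prop :=
  exists phi l, subseq phi /\ converges (fun n => u (phi n)) l.

Definition conv u : Prop := exists l, converges u l.

Lemma cauchy_conv u : cauchy u -> conv u.
Proof. apply complete. Qed.

Lemma converges_cauchy u l : converges u l -> cauchy u.
Proof.
  intros H e He; destruct (H (e/2)) as [N HN]; [lra|].
  exists N; intros n m Hn Hm.
  pose proof (norm_triangle3 (u n) l (u m)); rewrite (norm_sub_sym l) in *.
  pose proof (HN n Hn); pose proof (HN m Hm); lra.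
Qed.

(** The form in which coercive estimates are applied: a bound on differences transfers the Cauchy
    property. Two dominating sequences are allowed because a relative bound has two terms. *)
Lemma cauchy_dominated (K : R) u v w :
  (forall n m, norm (u n [-] u m) <= K * (norm (v n [-] v m) + norm (w n [-] w m))) ->
  cauchy v -> cauchy w -> cauchy u.
Proof.
  intros H Hv Hw e He.
  (* The sign of [K] is unknown, so a positive constant above it is used for the division. *)
  set (k := Rabs K + 1); assert (Hk : 0 < k /\ K <= k).
  { unfold k; pose proof (Rabs_pos K); pose proof (Rle_abs K); lra. }
  assert (He2 : 0 < e / (2 * k)) by (apply Rdiv_lt_0_compat; lra).
  destruct (Hv _ He2) as [N1 H1]; destruct (Hw _ He2) as [N2 H2].
  exists (Nat.max N1 N2); intros n m Hn Hm.
  specialize (H n m); specialize (H1 n m ltac:(lia) ltac:(lia)).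
  specialize (H2 n m ltac:(lia) ltac:(lia)).
  pose proof (norm_ge0 (v n [-] v m)); pose proof (norm_ge0 (w n [-] w m)).
  assert (E : k * (e / (2 * k) + e / (2 * k)) = e) by (field; lra).
  nra.
Qed.

Lemma converges_dominated (K : R) u v (l l' : X) :
  (forall n, norm (u n [-] l) <= K * norm (v n [-] l')) ->
  converges v l' -> converges u l.
Proof.
  intros H Hv e He.
  set (k := Rabs K + 1); assert (Hk : 0 < k /\ K <= k).
  { unfold k; pose proof (Rabs_pos K); pose proof (Rle_abs K); lra. }
  assert (He2 : 0 < e / k) by (apply Rdiv_lt_0_compat; lra).
  destruct (Hv _ He2) as [N1 H1]; exists N1; intros n Hn.
  specialize (H n); specialize (H1 n Hn); pose proof (norm_ge0 (v n [-] l')).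
  assert (E : k * (e / k) = e) by (field; lra).
  nra.
Qed.

Lemma converges_ext u v l : (forall n, u n = v n) -> converges u l -> converges v l.
Proof.
  intros E H e He; destruct (H e He) as [N HN]; exists N; intros n Hn.
  rewrite <- E; auto.
Qed.

Lemma converges_const x : converges (fun _ => x) x.
Proof.
  intros e He; exists 0%nat; intros n _.
  replace (x [-] x) with (vzero : X) by vec; rewrite norm_zero; exact He.
Qed.

Lemma converges_add u v l m :
  converges u l -> converges v m -> converges (fun n => u n [+] v n) (l [+] m).
Proof.
  intros H1 H2 e He; destruct (H1 (e/2)) as [N1 K1]; [lra|].
  destruct (H2 (e/2)) as [N2 K2]; [lra|].
  exists (Nat.max N1 N2); intros n Hn.
  replace (u n [+] v n [-] (l [+] m)) with ((u n [-] l) [+] (v n [-] m)) by vec.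
  eapply Rle_lt_trans; [apply norm_triangle|].
  specialize (K1 n ltac:(lia)); specialize (K2 n ltac:(lia)); lra.
Qed.

Lemma converges_vscal (c : Cx) u l :
  converges u l -> converges (fun n => vscal c (u n)) (vscal c l).
Proof.
  apply converges_dominated with (Rabs (Re c) + Rabs (Im c)); intros n.
  replace (vscal c (u n) [-] vscal c l) with (vscal c (u n [-] l)) by vec.
  apply norm_vscal_le.
Qed.

Lemma converges_opp u l : converges u l -> converges (fun n => vopp (u n)) (vopp l).
Proof.
  apply converges_dominated with 1; intros n.
  replace (vopp (u n) [-] vopp l) with (vopp (u n [-] l)) by vec.
  rewrite norm_opp; lra.
Qed.

Lemma converges_sub u v l m :
  converges u l -> converges v m -> converges (fun n => u n [-] v n) (l [-] m).
Proof. intros H1 H2; apply converges_add; [exact H1|]; apply converges_opp, H2. Qed.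

Lemma converges_subseq u l phi :
  subseq phi -> converges u l -> converges (fun n => u (phi n)) l.
Proof.
  intros Hp H e He; destruct (H e He) as [N HN]; exists N; intros n Hn.
  apply HN; pose proof (subseq_ge phi Hp n); lia.
Qed.

Lemma has_limit_point_subseq u phi :
  subseq phi -> has_limit_point (fun n => u (phi n)) -> has_limit_point u.
Proof.
  intros Hp (psi & l & Hs & Hl); exists (fun n => phi (psi n)), l; split; [|exact Hl].
  apply subseq_comp; assumption.
Qed.

Lemma converges_ri u l z : converges u l -> Un_cv (fun n => ri (u n) z) (ri l z).
Proof.
  intros H e He; pose proof (norm_ge0 z).
  assert (He2 : 0 < e / (norm z + 1)) by (apply Rdiv_lt_0_compat; lra).
  destruct (H _ He2) as [N HN]; exists N; intros n Hn; unfold Rdist.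
  rewrite <- ri_sub_l; eapply Rle_lt_trans; [apply cauchy_schwarz|].
  specialize (HN n Hn); pose proof (norm_ge0 (u n [-] l)).
  assert (E : e / (norm z + 1) * (norm z + 1) = e) by (field; lra).
  nra.
Qed.

Lemma converges_norm u l : converges u l -> Un_cv (fun n => norm (u n)) (norm l).
Proof.
  intros H e He; destruct (H e He) as [N HN]; exists N; intros n Hn; unfold Rdist.
  specialize (HN n Hn); pose proof (norm_le_sub (u n) l); pose proof (norm_le_sub l (u n)).
  rewrite (norm_sub_sym l) in *; apply Rabs_def1; lra.
Qed.

Lemma converges_bounded u l : converges u l -> exists M, forall n, norm (u n) <= M.
Proof.
  intros H; apply converges_norm in H.
  destruct (cauchy_bound _ (CV_Cauchy _ (exist _ _ H))) as [M HM]; exists M; intros n; apply HM; exists n; reflexivity.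
Qed.

Lemma separated_no_limit_point u :
  (forall n m, (n < m)%nat -> 1 <= norm (u n [-] u m)) -> ~ has_limit_point u.
Proof.
  intros H (phi & l & Hp & Hl); apply converges_cauchy in Hl.
  destruct (Hl 1 ltac:(lra)) as [N HN]; specialize (HN N (S N) ltac:(lia) ltac:(lia)).
  specialize (H _ _ (Hp N)); lra.
Qed.

End Limits.

(** * Orthogonal projection onto closed subspaces *)

Section Projection.
Context {X : HilbertSpace}.
Implicit Types (V : X -> Prop) (x y v p : X).

(** Real scalars suffice: on a subspace stable under [J], orthogonality for [ri] already implies
    complex orthogonality. *)
Definition real_subspace V : Prop :=
  V vzero /\ (forall x y, V x -> V y -> V (x [+] y)) /\ (forall t x, V x -> V (t [*] x)).

Definition closed_set V : Prop :=
  forall (u : nat -> X) l, (forall n, V (u n)) -> converges u l -> V l.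

Lemma real_subspace_sub V x y : real_subspace V -> V x -> V y -> V (x [-] y).
Proof.
  intros (_ & Ha & Hs) Hx Hy; replace (x [-] y) with (x [+] (-1) [*] y) by vec; auto.
Qed.

Lemma inv_S_pos n : 0 < / (INR n + 1).
Proof. apply Rinv_0_lt_compat; pose proof (pos_INR n); lra. Qed.

Lemma inv_S_small e : 0 < e -> exists N, forall n, (N <= n)%nat -> / (INR n + 1) < e.
Proof.
  intros He; destruct (cv_infty_cv_0 (fun n => INR n + 1)) with e as [N HN]; [|exact He|].
  - intros M; destruct (INR_unbounded M) as [N HN]; exists N; intros n Hn.
    apply le_INR in Hn; lra.
  - exists N; intros n Hn; specialize (HN n Hn); unfold Rdist in HN.
    rewrite Rminus_0_r in HN; apply Rabs_def2 in HN; lra.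
Qed.

Lemma le_lim_0 (a b : R) : (forall n, a <= b + / (INR n + 1)) -> a <= b.
Proof.
  intros H; apply Rnot_lt_le; intros Hlt.
  destruct (inv_S_small (a - b)) as [N HN]; [lra|].
  specialize (H N); specialize (HN N (Nat.le_refl N)); lra.
Qed.

Theorem projection V x : real_subspace V -> closed_set V ->
  exists p, V p /\ forall v, V v -> ri (x [-] p) v = 0.
Proof.
  intros (V0 & Vadd & Vrs) Vcl.
  (* Completeness of the reals supplies suprema, hence the minus sign: [- M] is the infimum of the
     squared distances. *)
  destruct (completeness (fun r => exists v, V v /\ r = - ri (x [-] v) (x [-] v)))
    as [M [HM1 HM2]].
  { exists 0; intros r (v & _ & ->); pose proof (ri_pos (x [-] v)); lra. }
  { exists (- ri (x [-] vzero) (x [-] vzero)), vzero; auto. }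
  assert (Hmin : forall v, V v -> - M <= ri (x [-] v) (x [-] v)).
  { intros v Hv; specialize (HM1 _ (ex_intro _ v (conj Hv eq_refl))); lra. }
  assert (Hex : forall n : nat, exists v,
    V v /\ ri (x [-] v) (x [-] v) < - M + / (INR n + 1)).
  { intros n; apply NNPP; intros H; pose proof (inv_S_pos n).
    enough (M <= M - / (INR n + 1)) by lra.
    apply HM2; intros r (v & Hv & ->); apply Rnot_lt_le; intros Hlt.
    apply H; exists v; split; [exact Hv|lra]. }
  apply choice in Hex; destruct Hex as [v Hv].
  destruct (cauchy_conv v) as [p Hp].
  { intros e He; destruct (inv_S_small (e * e / 4)) as [N HN]; [nra|].
    exists N; intros n m Hn Hm.
    destruct (Hv n) as [Vn Kn]; destruct (Hv m) as [Vm Km].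
    pose proof (HN n Hn); pose proof (HN m Hm).
    pose proof (Hmin (/2 [*] (v n [+] v m)) ltac:(auto)) as H1.
    pose proof (norm_ge0 (v n [-] v m)).
    enough (norm (v n [-] v m) * norm (v n [-] v m) < e * e) by nra.
    rewrite norm_sqr.
    (* parallelogram identity *)
    assert (E : ri (v n [-] v m) (v n [-] v m)
      = 2 * ri (x [-] v n) (x [-] v n) + 2 * ri (x [-] v m) (x [-] v m)
        - 4 * ri (x [-] /2 [*] (v n [+] v m)) (x [-] /2 [*] (v n [+] v m))).
    { autorewrite with ri_both; rewrite (ri_sym (v m) (v n)), (ri_sym (v n) x), (ri_sym (v m) x); field. }
    lra. }
  exists p; split; [apply Vcl with v; [intros n; apply Hv|exact Hp]|].
  intros w Hw.
  (* First variation: comparing [v n] with the competitor [v n + t w] bounds the linear term in [t]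
     by the quadratic one, up to the defect [1 / (n + 1)] of minimality, which vanishes in the
     limit. *)
  assert (Hq : forall t, 2 * t * ri (x [-] p) w <= t * t * ri w w).
  { intros t.
    assert (Hn : forall n, 2 * t * ri (x [-] v n) w <= t * t * ri w w + / (INR n + 1)).
    { intros n; destruct (Hv n) as [Vn Kn].
      pose proof (Hmin (v n [+] t [*] w) ltac:(auto)) as H1.
      replace (ri (x [-] (v n [+] t [*] w)) (x [-] (v n [+] t [*] w)))
        with (ri (x [-] v n) (x [-] v n) - 2 * t * ri (x [-] v n) w + t * t * ri w w) in H1.
      2: { autorewrite with ri_both; rewrite (ri_sym w x), (ri_sym w (v n)); ring. }
      lra. }
    apply le_lim_0; intros n0; pose proof (inv_S_pos n0) as Hpos.
    assert (Hc : Un_cv (fun n => 2 * t * ri (x [-] v n) w) (2 * t * ri (x [-] p) w)).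
    { apply CV_mult; [intros e He; exists 0%nat; intros; unfold Rdist; rewrite Rminus_diag, Rabs_R0; exact He|].
      apply converges_ri, converges_sub; [apply converges_const|exact Hp]. }
    set (h := / (INR n0 + 1)) in *.
    destruct (Hc (h / 2)) as [N1 H1]; [lra|].
    destruct (inv_S_small (h / 2)) as [N2 H2]; [lra|].
    specialize (H1 (Nat.max N1 N2) ltac:(lia)); specialize (H2 (Nat.max N1 N2) ltac:(lia)).
    specialize (Hn (Nat.max N1 N2)); unfold Rdist in H1; apply Rabs_def2 in H1; lra. }
  set (a := ri (x [-] p) w) in *; set (q := ri w w) in *.
  assert (Hq0 : 0 <= q) by apply ri_pos.
  (* A near-optimal [t], with the summand 1 covering [q = 0]; it leaves [t^2 (q + 2) <= 0], hence
     [a = 0]. *)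
  specialize (Hq (a / (q + 1))).
  assert (E : 2 * (a / (q + 1)) * a - a / (q + 1) * (a / (q + 1)) * q
            = (a / (q + 1)) * (a / (q + 1)) * (q + 2)) by (field; lra).
  assert (E2 : a = a / (q + 1) * (q + 1)) by (field; lra).
  assert (a / (q + 1) = 0) by nra.
  rewrite E2, H; ring.
Qed.

End Projection.

(** * Finite-dimensional tools: bounded real sequences and linear systems *)

Lemma bounded_real_subseq (a : nat -> R) M : (forall n, Rabs (a n) <= M) ->
  exists phi l, subseq phi /\ Un_cv (fun n => a (phi n)) l.
Proof.
  intros HM.
  destruct (Bolzano_Weierstrass a (fun c => - M <= c <= M)) as [l Hl].
  { apply compact_P3. }
  { intros n; specialize (HM n); split; [|apply Rle_trans with (2 := HM), Rle_abs].
    pose proof (Rle_abs (- a n)); rewrite Rabs_Ropp in *; lra. }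
  assert (Hex : forall k : nat * nat, exists p,
    (fst k <= p)%nat /\ Rabs (a p - l) < / (INR (snd k) + 1)).
  { intros [N n]; simpl; apply (Hl (fun c => Rabs (c - l) < / (INR n + 1)) N).
    exists (mkposreal _ (inv_S_pos n)); intros c Hc; exact Hc. }
  apply choice in Hex; destruct Hex as [pick Hpick].
  (* Each index is sought from [S (phi k)] on, which makes [phi] strictly increasing. *)
  set (phi := fix phi n := match n with
    | O => pick (O, O) | S k => pick (S (phi k), S k) end).
  exists phi, l; split.
  - intros n; destruct (Hpick (S (phi n), S n)) as [H _]; simpl in *; lia.
  - assert (H : forall n, Rabs (a (phi n) - l) < / (INR n + 1)).
    { intros [|n]; apply Hpick. }
    intros e He; destruct (inv_S_small e He) as [N HN]; exists N; intros n Hn.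
    specialize (H n); specialize (HN n Hn); unfold Rdist; lra.
Qed.

Lemma Cmul_eq0 a b : Cmul a b = C0 -> a = C0 \/ b = C0.
Proof.
  destruct a as [p q], b as [r s]; intros H; injection H; intros H1 H2.
  assert (E : (p * p + q * q) * (r * r + s * s) = 0).
  { replace ((p * p + q * q) * (r * r + s * s))
      with ((p * r - q * s) * (p * r - q * s) + (p * s + q * r) * (p * s + q * r)) by ring.
    rewrite H1, H2; ring. }
  apply Rmult_integral in E; destruct E as [E|E]; [left|right]; unfold C0; f_equal; nra.
Qed.

Definition coef_linear (L : (nat -> Cx) -> Cx) : Prop := forall a b c d,
  L (fun i => Cadd (Cmul a (c i)) (Cmul b (d i))) = Cadd (Cmul a (L c)) (Cmul b (L d)).

(* The support is an arbitrary list so that, in the inductive step, the first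
   solution [c] can be paired with one vanishing at an index where [c] does not. *)
Lemma underdetermined_system k : forall (L : nat -> (nat -> Cx) -> Cx) (s : list nat),
  (forall j, coef_linear (L j)) -> NoDup s -> length s = S k ->
  exists c, (exists i, In i s /\ c i <> C0) /\ (forall i, ~ In i s -> c i = C0) /\
    forall j, (j < k)%nat -> L j c = C0.
Proof.
  induction k as [|k IH]; intros L s HL Hnd Hlen.
  - destruct s as [|i0 s]; [discriminate|].
    exists (fun i => if Nat.eq_dec i i0 then C1 else C0); repeat split.
    + exists i0; split; [left; reflexivity|]; destruct (Nat.eq_dec i0 i0); [|easy].
      intros H; injection H; lra.
    + intros i Hi; destruct (Nat.eq_dec i i0) as [->|]; [|easy].
      exfalso; apply Hi; left; reflexivity.
    + intros j Hj; lia.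
  - destruct s as [|i0 s]; [discriminate|]; inversion Hnd as [|? ? Hni Hnd']; subst.
    destruct (IH L s HL Hnd') as (c & (j & Hj & Hcj) & Hc0 & HcL); [simpl in Hlen; lia|].
    (* A second solution of the first [k] equations, supported away from [j], where [c] is
       nonzero. *)
    destruct (IH L (i0 :: remove Nat.eq_dec j s) HL) as (d & (i & Hi & Hdi) & Hd0 & HdL).
    { constructor; [intros H; apply in_remove in H; tauto|].
      rewrite <- remove_alt; apply NoDup_filter, Hnd'. }
    { simpl in *; f_equal.
      assert (Hl : length s = S (length (remove Nat.eq_dec j s))).
      { clear -Hnd' Hj; induction s as [|b s IHs]; [easy|]; inversion Hnd'; subst; simpl.
        destruct (Nat.eq_dec j b) as [->|Hne].
        - rewrite notin_remove; [reflexivity|assumption].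
        - simpl; rewrite <- IHs; [reflexivity|assumption|destruct Hj; [congruence|assumption]]. }
      lia. }
    assert (Hdj : d j = C0).
    { apply Hd0; intros [->|H]; [easy|]; apply remove_In in H; easy. }
    assert (Hsub : forall i, ~ In i (i0 :: s) -> c i = C0 /\ d i = C0).
    { intros i' Hi'; split; [apply Hc0; simpl in Hi'; tauto|].
      apply Hd0; intros [->|H]; apply Hi'; [left; easy|].
      right; apply in_remove in H; tauto. }
    destruct (classic (L k d = C0)) as [Hk|Hk].
    + exists d; split; [exists i; split; [|exact Hdi]|split].
      * destruct Hi as [->|H]; [left; easy|]; right; apply in_remove in H; tauto.
      * intros i' Hi'; apply Hsub, Hi'.
      * intros j' Hj'; destruct (Nat.eq_dec j' k) as [->|]; [exact Hk|apply HdL; lia].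
    (* The coefficients are chosen to cancel equation [k]. At [j] only the multiple of [c] survives,
       with the nonzero factor [L k d]. *)
    + exists (fun n => Cadd (Cmul (L k d) (c n)) (Cmul (Copp (L k c)) (d n))).
      split; [exists j; split; [right; exact Hj|]|split].
      * rewrite Hdj; intros H; assert (H' : Cmul (L k d) (c j) = C0).
        { rewrite <- H; apply Cx_eq; simpl; ring. }
        apply Cmul_eq0 in H'; tauto.
      * intros i' Hi'; destruct (Hsub i' Hi') as [-> ->]; apply Cx_eq; simpl; ring.
      * intros j' Hj'; rewrite HL; destruct (Nat.eq_dec j' k) as [->|].
        -- apply Cx_eq; simpl; ring.
        -- rewrite (HcL j'), (HdL j') by lia; apply Cx_eq; simpl; ring.
Qed.

(** * Finite and infinite dimension *)

Section Dimension.
Context {X : HilbertSpace}.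
Implicit Types (V : X -> Prop) (x y u v e : X).

(** No finite list of functionals separates the points of [V]. In this form orthogonal sequences are
    picked directly, and the negation hands over the finite list on which [finite_dim_compact] runs
    its induction. *)
Definition infinite_dim V : Prop :=
  forall es : list X, exists u, V u /\ u <> vzero /\ forall e, In e es -> ri u e = 0.

Lemma converges_rs_const (a : nat -> R) b v :
  Un_cv a b -> converges (fun n => a n [*] v) (b [*] v).
Proof.
  intros H e He; pose proof (norm_ge0 v).
  assert (He2 : 0 < e / (norm v + 1)) by (apply Rdiv_lt_0_compat; lra).
  destruct (H _ He2) as [N HN]; exists N; intros n Hn; specialize (HN n Hn).
  replace (a n [*] v [-] b [*] v) with ((a n - b) [*] v) by vec; rewrite norm_rs.
  unfold Rdist in HN; pose proof (Rabs_pos (a n - b)).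
  assert (E : e / (norm v + 1) * (norm v + 1) = e) by (field; lra).
  nra.
Qed.

(** Heine-Borel by induction on the separating functionals: if [e] is nonzero at some [v] in [V],
    subtracting a multiple of [v] moves the sequence into the part of [V] orthogonal to [e], and the
    multiples form a bounded real sequence. *)
Lemma finite_dim_compact (es : list X) : forall V, real_subspace V ->
  (forall u, V u -> (forall e, In e es -> ri u e = 0) -> u = vzero) ->
  forall (p : nat -> X) M, (forall n, V (p n)) -> (forall n, norm (p n) <= M) ->
  has_limit_point p.
Proof.
  induction es as [|e es IH]; intros V HV Htriv p M Hp HM.
  - exists (fun n => n), vzero; split; [intros n; lia|].
    apply converges_ext with (fun _ => vzero); [|apply converges_const].
    intros n; symmetry; apply Htriv; [apply Hp|easy].
  - pose proof HV as (V0 & Vadd & Vrs).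
    set (V' := fun u => V u /\ ri u e = 0).
    assert (HV' : real_subspace V').
    { split; [|split].
      - split; [exact V0|apply ri_zero_l].
      - intros x y [Hx Ex] [Hy Ey]; split; [auto|]; rewrite ri_add_l; lra.
      - intros t x [Hx Ex]; split; [auto|]; rewrite ri_rs_l, Ex; ring. }
    assert (Htriv' : forall u, V' u -> (forall e, In e es -> ri u e = 0) -> u = vzero).
    { intros u [Hu Eu] H; apply Htriv; [exact Hu|]; intros e' [<-|He']; auto. }
    destruct (classic (exists v, V v /\ ri v e <> 0)) as [(v & Hv & Ev)|Hno].
    + set (a := fun n => ri (p n) e / ri v e).
      destruct (bounded_real_subseq a (M * norm e / Rabs (ri v e))) as (phi & b & Hphi & Hb).
      { intros n; unfold a; unfold Rdiv; rewrite Rabs_mult, Rabs_inv.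
        apply Rmult_le_compat_r.
        - left; apply Rinv_0_lt_compat, Rabs_pos_lt, Ev.
        - eapply Rle_trans; [apply cauchy_schwarz|].
          apply Rmult_le_compat_r; [apply norm_ge0|apply HM]. }
      destruct (IH V' HV' Htriv' (fun n => p (phi n) [-] a (phi n) [*] v)
        (M + M * norm e / Rabs (ri v e) * norm v)) as (psi & l & Hpsi & Hl).
      { intros n; split; [apply real_subspace_sub; auto|].
        rewrite ri_sub_l, ri_rs_l; unfold a; field; exact Ev. }
      { intros n; eapply Rle_trans; [apply norm_sub_le|]; rewrite norm_rs.
        apply Rplus_le_compat; [apply HM|].
        apply Rmult_le_compat_r; [apply norm_ge0|].
        unfold a, Rdiv; rewrite Rabs_mult, Rabs_inv.
        apply Rmult_le_compat_r.
        - left; apply Rinv_0_lt_compat, Rabs_pos_lt, Ev.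
        - eapply Rle_trans; [apply cauchy_schwarz|].
          apply Rmult_le_compat_r; [apply norm_ge0|apply HM]. }
      exists (fun n => phi (psi n)), (l [+] b [*] v); split; [apply subseq_comp; assumption|].
      eapply converges_ext; [|apply converges_add; [exact Hl|]].
      2: { apply converges_subseq with (phi := psi); [exact Hpsi|].
           apply converges_rs_const, Hb. }
      intros n; simpl; vec.
    + apply (IH V' HV' Htriv' p M); [|exact HM].
      intros n; split; [apply Hp|]; apply NNPP; intros H; apply Hno; eauto.
Qed.

Lemma lin_comb_ri (c : nat -> Cx) (v : nat -> X) e n :
  (forall i, (i < n)%nat -> ri (v i) e = 0 /\ ri (v i) (J e) = 0) ->
  ri (lin_comb X c v n) e = 0.
Proof.
  induction n as [|n IH]; intros H; simpl; [apply ri_zero_l|].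
  rewrite ri_add_l, ri_vscal_l, IH by auto with arith.
  destruct (H n) as [-> ->]; [lia|]; ring.
Qed.

Lemma lin_comb_coef_linear (v : nat -> X) n e :
  coef_linear (fun c => inner (lin_comb X c v n) e).
Proof.
  intros a b c d; induction n as [|n IH]; simpl.
  - rewrite inner_ri, !ri_zero_l; apply Cx_eq; simpl; ring.
  - rewrite !inner_add_l, !inner_scal_l, IH; apply Cx_eq; simpl; ring.
Qed.

Lemma lin_comb_in V c (v : nat -> X) n : V vzero ->
  (forall x y, V x -> V y -> V (x [+] y)) -> (forall a x, V x -> V (vscal a x)) ->
  (forall i, (i < n)%nat -> V (v i)) -> V (lin_comb X c v n).
Proof.
  intros H0 Ha Hs; induction n as [|n IH]; intros H; simpl; auto with arith.
Qed.

(** One more independent vector than there are elements of [es]: orthogonality to [es] is then an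
    underdetermined complex system for the coefficients. *)
Lemma independent_infinite_dim V : V vzero ->
  (forall x y, V x -> V y -> V (x [+] y)) -> (forall a x, V x -> V (vscal a x)) ->
  (forall n, exists v : nat -> X, (forall i, (i < n)%nat -> V (v i)) /\
    forall c, lin_comb X c v n = vzero -> forall i, (i < n)%nat -> c i = C0) ->
  infinite_dim V.
Proof.
  intros H0 Ha Hs H es; set (n := S (length es)).
  destruct (H n) as (v & Hv & Hind).
  destruct (underdetermined_system (length es)
    (fun j c => inner (lin_comb X c v n) (nth j es vzero)) (seq 0 n))
    as (c & (i & Hi & Hci) & _ & HL).
  { intros j; apply lin_comb_coef_linear. }
  { apply seq_NoDup. }
  { apply length_seq. }
  exists (lin_comb X c v n); split; [apply lin_comb_in; assumption|split].
  - intros E; apply Hci, (Hind c E); apply in_seq in Hi; lia.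
  - intros e He; apply In_nth with (d := vzero) in He; destruct He as (j & Hj & <-).
    unfold ri; rewrite HL by exact Hj; reflexivity.
Qed.

Lemma infinite_dim_orthogonal_seq V : infinite_dim V ->
  exists v : nat -> X, (forall n, V (v n) /\ v n <> vzero) /\
    forall i n, (i < n)%nat -> ri (v n) (v i) = 0 /\ ri (v n) (J (v i)) = 0.
Proof.
  intros H; unfold infinite_dim in H; apply choice in H; destruct H as [pick Hpick].
  (* Both the vector and its image under [J] are recorded, so that later vectors are orthogonal in
     the complex sense. *)
  set (es := fix es n := match n with
    | O => nil | S k => pick (es k) :: J (pick (es k)) :: es k end).
  exists (fun n => pick (es n)); split; [intros n; destruct (Hpick (es n)); tauto|].
  intros i n Hin.
  assert (HIn : In (pick (es i)) (es n) /\ In (J (pick (es i))) (es n)).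
  { induction Hin as [|n Hin IH]; simpl; tauto. }
  split; apply (Hpick (es n)); tauto.
Qed.

Lemma infinite_dim_independent V : infinite_dim V ->
  forall n, exists v : nat -> X, (forall i, (i < n)%nat -> V (v i)) /\
    forall c, lin_comb X c v n = vzero -> forall i, (i < n)%nat -> c i = C0.
Proof.
  intros H n; destruct (infinite_dim_orthogonal_seq V H) as (v & Hv & Ho).
  exists v; split; [intros i _; apply Hv|]; intros c.
  induction n as [|n IH]; intros Hc i Hi; [lia|]; simpl in Hc.
  (* Pairing the vanishing combination with [v n] and [J (v n)] isolates the real and imaginary
     parts of the last coefficient. *)
  assert (Hn : forall e, (e = v n \/ e = J (v n)) -> ri (vscal (c n) (v n)) e = 0).
  { intros e He; transitivity (ri (lin_comb X c v n [+] vscal (c n) (v n)) e).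
    2: rewrite Hc; apply ri_zero_l.
    rewrite ri_add_l, lin_comb_ri; [ring|].
    intros j Hj; destruct (Ho j n Hj) as [E1 E2].
    destruct He as [->| ->]; split; rewrite ?ri_JJ, ?(ri_sym _ (J _)), ?ri_J_l.
    all: rewrite ?(ri_sym _ (v n)); try lra. }
  assert (Hcn : c n = C0).
  { pose proof (Hn _ (or_introl eq_refl)) as E1; pose proof (Hn _ (or_intror eq_refl)) as E2.
    rewrite ri_vscal_l, ri_self_J in E1; rewrite ri_vscal_l, ri_self_J, ri_JJ in E2.
    assert (Hne : ri (v n) (v n) <> 0) by (intros E; apply (Hv n), ri_def, E).
    apply Cx_eq; simpl; apply Rmult_eq_reg_r with (ri (v n) (v n)); try exact Hne; lra. }
  destruct (Nat.eq_dec i n) as [->|]; [exact Hcn|]; apply IH; [|lia].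
  rewrite <- Hc, Hcn; vec.
Qed.

End Dimension.

(** * Symmetric and self-adjoint relations, and their resolvent sets *)

Section Relations.
Context {X : HilbertSpace}.
Implicit Types (T : rel X) (x y f g : X).

Definition symmetric T : Prop := forall x f y g, T x f -> T y g -> ri g x = ri y f.

Definition sa T : Prop := is_subspace X T /\ selfadjoint X T.

Lemma rel_add T x f y g : is_subspace X T -> T x f -> T y g -> T (x [+] y) (f [+] g).
Proof. intros (_ & H & _); apply H. Qed.

Lemma rel_vscal T a x f : is_subspace X T -> T x f -> T (vscal a x) (vscal a f).
Proof. intros (_ & _ & H); apply H. Qed.

Lemma rel_rs T t x f : is_subspace X T -> T x f -> T (t [*] x) (t [*] f).
Proof. apply rel_vscal. Qed.

Lemma rel_sub T x f y g : is_subspace X T -> T x f -> T y g -> T (x [-] y) (f [-] g).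
Proof.
  intros HT H1 H2; pose proof (rel_vscal T (mkC (-1) 0) y g HT H2) as H3.
  pose proof (rel_add T _ _ _ _ HT H1 H3) as H.
  replace (x [-] y) with (x [+] vscal (mkC (-1) 0) y) by vec.
  replace (f [-] g) with (f [+] vscal (mkC (-1) 0) g) by vec; exact H.
Qed.

Lemma hermitian_symmetric T : hermitian X T -> symmetric T.
Proof. intros H x f y g Hx Hy; unfold ri; rewrite (H y g Hy x f Hx); reflexivity. Qed.

(** The imaginary part of the adjoint identity is its real part for the pair [(J x, J f)], which
    lies in [T] as well. *)
Lemma adjoint_of_re T y g : is_subspace X T ->
  (forall x f, T x f -> ri g x = ri y f) -> adjoint X T y g.
Proof.
  intros HT H x f Hx; rewrite !inner_ri; f_equal; [apply H, Hx|].
  apply H; unfold J; apply rel_vscal; assumption.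
Qed.

Lemma sa_symmetric T : sa T -> symmetric T.
Proof. intros [_ H]; apply hermitian_symmetric; intros x f; apply H. Qed.

Lemma sa_maximal T y g : sa T -> (forall x f, T x f -> ri g x = ri y f) -> T y g.
Proof. intros [HT H] K; apply H, adjoint_of_re; assumption. Qed.

Lemma sa_intro T : is_subspace X T -> symmetric T ->
  (forall y g, (forall x f, T x f -> ri g x = ri y f) -> T y g) -> sa T.
Proof.
  intros HT Hs Hm; split; [exact HT|]; intros y g; split; intros H.
  - apply adjoint_of_re; [exact HT|]; intros x f Hx; exact (Hs x f y g Hx H).
  - apply Hm; intros x f Hx; unfold ri; rewrite (H x f Hx); reflexivity.
Qed.

Lemma sa_closed T : sa T -> rel_closed X T.
Proof.
  intros HT x f x0 f0 Hn Hx Hf; apply sa_maximal; [exact HT|]; intros y g Hy.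
  eapply UL_sequence; [apply converges_ri, Hf|].
  eapply Un_cv_ext; [|apply converges_ri, Hx].
  intros n; symmetry; exact (sa_symmetric T HT y g (x n) (f n) Hy (Hn n)).
Qed.

(** The relation [T - t I], for real [t]. *)
Definition shift (t : R) T : rel X := fun x y => T x (y [+] t [*] x).

Lemma shift_sa t T : sa T -> sa (shift t T).
Proof.
  intros HT; pose proof HT as [HS _]; apply sa_intro.
  - split; [|split]; unfold shift.
    + replace (vzero [+] t [*] vzero) with (vzero : X) by vec; apply HS.
    + intros x f y g Hx Hy.
      replace (f [+] g [+] t [*] (x [+] y)) with ((f [+] t [*] x) [+] (g [+] t [*] y)) by vec.
      apply rel_add; assumption.
    + intros a x f Hx.
      replace (vscal a f [+] t [*] vscal a x) with (vscal a (f [+] t [*] x)) by vec.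
      apply rel_vscal; assumption.
  - intros x f y g Hx Hy; pose proof (sa_symmetric T HT _ _ _ _ Hx Hy) as H.
    autorewrite with ri_both in H; lra.
  - intros y g H; apply (sa_maximal T); [exact HT|]; intros x f Hx.
    assert (K : shift t T x (f [-] t [*] x)).
    { unfold shift; replace (f [-] t [*] x [+] t [*] x) with f by vec; exact Hx. }
    apply H in K; autorewrite with ri_both in *; lra.
Qed.

Definition bounded_below T (l : Cx) : Prop :=
  exists c, 0 < c /\ forall x f, T x f -> c * norm x <= norm (f [-] vscal l x).

Lemma shift_bounded_below t s T :
  bounded_below T (mkC (t + s) 0) -> bounded_below (shift t T) (mkC s 0).
Proof.
  intros (c & Hc & H); exists c; split; [exact Hc|]; intros x f Hx.
  replace (f [-] vscal (mkC s 0) x)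
    with (f [+] t [*] x [-] vscal (mkC (t + s) 0) x) by vec.
  apply H, Hx.
Qed.

(** The form [<f, x>] is real: symmetry is applied to [(x, f)] and its multiple by the imaginary
    unit. *)
Lemma symmetric_form_real T x f : is_subspace X T -> symmetric T -> T x f -> ri f (J x) = 0.
Proof.
  intros HT Hs Hx; pose proof (rel_vscal T (mkC 0 1) x f HT Hx) as HJ.
  pose proof (Hs _ _ _ _ Hx HJ) as H; change (ri (J f) x = ri (J x) f) in H.
  rewrite ri_J_l, (ri_sym (J x)) in H; lra.
Qed.

(** The cross term between [(T - Re l) x] and [Im l J x] vanishes because the form of [T] is
    real. *)
Lemma symmetric_sub_vscal T l x f : is_subspace X T -> symmetric T -> T x f ->
  ri (f [-] vscal l x) (f [-] vscal l x)
  = ri (f [-] Re l [*] x) (f [-] Re l [*] x) + Im l * Im l * ri x x.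
Proof.
  intros HT Hs Hx; pose proof (symmetric_form_real T x f HT Hs Hx) as H.
  replace (f [-] vscal l x) with ((f [-] Re l [*] x) [-] Im l [*] J x) by vec.
  set (h := f [-] Re l [*] x).
  assert (E : ri h (J x) = 0).
  { unfold h; rewrite ri_sub_l, ri_rs_l, H, ri_self_J; ring. }
  autorewrite with ri_both; rewrite (ri_sym (J x) h), E, ri_J_l, ri_JJ; ring.
Qed.

Lemma symmetric_lower_bound T l x f : is_subspace X T -> symmetric T -> T x f ->
  Rabs (Im l) * norm x <= norm (f [-] vscal l x).
Proof.
  intros HT Hs Hx; apply norm_ge; rewrite (symmetric_sub_vscal T) by assumption.
  replace (Rabs (Im l) * norm x * (Rabs (Im l) * norm x))
    with ((Rabs (Im l) * Rabs (Im l)) * (norm x * norm x)) by ring.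
  rewrite norm_sqr; pose proof (Rsqr_abs (Im l)) as E2; unfold Rsqr in E2; rewrite <- E2.
  pose proof (ri_pos (f [-] Re l [*] x)); lra.
Qed.

Lemma nonreal_bounded_below T l : is_subspace X T -> symmetric T -> Im l <> 0 ->
  bounded_below T l.
Proof.
  intros HT Hs Hl; exists (Rabs (Im l)); split; [apply Rabs_pos_lt, Hl|].
  intros x f Hx; apply (symmetric_lower_bound T); assumption.
Qed.

(** The lower bound and closedness of [T] make the range of [T - l] closed, so each [y] can be
    projected onto it; the remainder is orthogonal to the range, hence zero. *)
Lemma range_full T l : is_subspace X T -> rel_closed X T -> bounded_below T l ->
  (forall r, (forall x f, T x f -> ri r (f [-] vscal l x) = 0) -> r = vzero) ->
  forall y, exists x f, T x f /\ y = f [-] vscal l x.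
Proof.
  intros HT Hcl (c & Hc & Hb) Hperp y.
  set (V := fun w : X => exists x f, T x f /\ w = f [-] vscal l x).
  destruct (projection V y) as (p & Hp & Ho).
  - split; [|split].
    + exists vzero, vzero; split; [apply HT|vec].
    + intros w1 w2 (x & f & Hx & ->) (x' & f' & Hx' & ->).
      exists (x [+] x'), (f [+] f'); split; [apply rel_add; assumption|vec].
    + intros t w (x & f & Hx & ->); exists (t [*] x), (t [*] f).
      split; [apply rel_rs; assumption|vec].
  - intros w w0 Hw Hlim.
    assert (Hex : forall n, exists q : X * X,
      T (fst q) (snd q) /\ w n = snd q [-] vscal l (fst q)).
    { intros n; destruct (Hw n) as (x & f & H); exists (x, f); exact H. }
    apply choice in Hex; destruct Hex as [q Hq].
    destruct (cauchy_conv (fun n => fst (q n))) as [x Hx].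
    { apply cauchy_dominated with (K := / c) (v := w) (w := w);
        [|eapply converges_cauchy, Hlim..].
      intros n m; destruct (Hq n) as [Tn En]; destruct (Hq m) as [Tm Em].
      pose proof (Hb _ _ (rel_sub T _ _ _ _ HT Tn Tm)) as H.
      replace (snd (q n) [-] snd (q m) [-] vscal l (fst (q n) [-] fst (q m)))
        with (w n [-] w m) in H by (rewrite En, Em; vec).
      pose proof (norm_ge0 (w n [-] w m)).
      apply Rmult_le_reg_l with c; [exact Hc|].
      rewrite <- Rmult_assoc, Rinv_r, Rmult_1_l by lra; lra. }
    exists x, (w0 [+] vscal l x); split; [|vec].
    apply Hcl with (fun n => fst (q n)) (fun n => w n [+] vscal l (fst (q n))).
    + intros n; destruct (Hq n) as [Tn ->].
      replace (snd (q n) [-] vscal l (fst (q n)) [+] vscal l (fst (q n))) with (snd (q n)) by vec.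
      exact Tn.
    + exact Hx.
    + apply converges_add; [exact Hlim|]; apply converges_vscal, Hx.
  - assert (E : y [-] p = vzero).
    { apply Hperp; intros x f Hx; apply Ho; exists x, f; auto. }
    apply vadd_opp_eq in E; rewrite E; exact Hp.
Qed.

(** A vector [r] orthogonal to the range satisfies [(r, conj l r)] in [T] by maximality. Reality of
    the form then gives [Im l |r|^2 = 0]; for real [l], [r] is in the kernel of [T - l], which the
    lower bound makes trivial. *)
Lemma sa_range_full T l : sa T -> bounded_below T l ->
  forall y, exists x f, T x f /\ y = f [-] vscal l x.
Proof.
  intros HT Hb; pose proof HT as [HS _]; pose proof (sa_symmetric T HT) as Hs.
  apply range_full; [exact HS|apply sa_closed, HT|exact Hb|]; intros r Hr.
  assert (Tr : T r (vscal (Cconj l) r)).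
  { apply sa_maximal; [exact HT|]; intros x f Hx; specialize (Hr x f Hx).
    rewrite ri_sub_r, (ri_sym r (vscal l x)), ri_vscal_l in Hr; rewrite ri_vscal_l; simpl.
    rewrite (ri_sym x r), <- (ri_sym (J r)), ri_J_l in Hr; lra. }
  pose proof (symmetric_form_real T _ _ HS Hs Tr) as H.
  rewrite ri_vscal_l, ri_self_J, ri_JJ in H; simpl in H.
  assert (H' : Im l * ri r r = 0) by lra; apply Rmult_integral in H'; destruct H' as [H'|H'].
  - destruct Hb as (c & Hc & Hb); specialize (Hb _ _ Tr).
    replace (vscal (Cconj l) r [-] vscal l r) with (vzero : X) in Hb.
    + rewrite norm_zero in Hb; apply norm_eq0; nra.
    + vec; rewrite H'; ring.
  - apply ri_def, H'.
Qed.

Lemma rel_inv_char T l y x :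
  rel_inv X (rel_sum X (lamI X l) (rel_opp X T)) y x <-> T x (vscal l x [-] y).
Proof.
  unfold rel_inv, rel_sum, lamI, rel_opp; split.
  - intros (f & g & -> & Hg & ->).
    replace (vscal l x [-] (vscal l x [+] g)) with (vopp g) by vec; exact Hg.
  - intros H; exists (vscal l x), (y [-] vscal l x); split; [easy|split; [|vec]].
    replace (vopp (y [-] vscal l x)) with (vscal l x [-] y) by vec; exact H.
Qed.

Lemma resolvent_bounded_below T l : sa T -> resolvent X T l <-> bounded_below T l.
Proof.
  intros HT; pose proof HT as [HS _]; split.
  - intros (_ & _ & _ & M & HM); exists (/ (Rabs M + 1)); pose proof (Rabs_pos M).
    split; [apply Rinv_0_lt_compat; lra|]; intros x f Hx.
    apply Rmult_le_reg_l with (Rabs M + 1); [lra|].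
    rewrite <- Rmult_assoc, Rinv_r, Rmult_1_l by lra.
    assert (K : norm x <= M * norm (vscal l x [-] f)).
    { apply HM, rel_inv_char.
      replace (vscal l x [-] (vscal l x [-] f)) with f by vec; exact Hx. }
    rewrite norm_sub_sym in K; pose proof (norm_ge0 (f [-] vscal l x)).
    pose proof (Rle_abs M); nra.
  - intros Hb; split; [|split; [|split]].
    + split; [|split].
      * apply rel_inv_char; replace (vscal l vzero [-] vzero) with (vzero : X) by vec.
        apply HS.
      * intros x f y g H1 H2; apply rel_inv_char in H1, H2; apply rel_inv_char.
        replace (vscal l (f [+] g) [-] (x [+] y))
          with ((vscal l f [-] x) [+] (vscal l g [-] y)) by vec.
        apply rel_add; assumption.
      * intros a x f H1; apply rel_inv_char in H1; apply rel_inv_char.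
        replace (vscal l (vscal a f) [-] vscal a x) with (vscal a (vscal l f [-] x)) by vec.
        apply rel_vscal; assumption.
    + intros y x1 x2 H1 H2; apply rel_inv_char in H1, H2.
      pose proof (rel_sub T _ _ _ _ HS H1 H2) as H; destruct Hb as (c & Hc & Hb).
      apply Hb in H.
      replace (vscal l x1 [-] y [-] (vscal l x2 [-] y) [-] vscal l (x1 [-] x2))
        with (vzero : X) in H by vec.
      rewrite norm_zero in H; apply vadd_opp_eq, norm_eq0; unfold vsub in H; nra.
    (* The resolvent inverts [l - T] while the range concerns [T - l], hence the sign of [y]. *)
    + intros y; destruct (sa_range_full T l HT Hb (vopp y)) as (x & f & Hx & E).
      exists x; apply rel_inv_char.
      replace (vscal l x [-] y) with f; [exact Hx|].
      replace (vscal l x [-] y) with (vscal l x [+] vopp y) by vec; rewrite E; vec.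
    + destruct Hb as (c & Hc & Hb); exists (/ c); intros y x H; apply rel_inv_char in H.
      apply Hb in H; replace (vscal l x [-] y [-] vscal l x) with (vopp y) in H by vec.
      rewrite norm_opp in H; apply Rmult_le_reg_l with c; [exact Hc|].
      rewrite <- Rmult_assoc, Rinv_r, Rmult_1_l by lra; exact H.
Qed.

Lemma spectrum_bounded_below T l : sa T -> spectrum X T l <-> ~ bounded_below T l.
Proof.
  intros HT; unfold spectrum; rewrite (resolvent_bounded_below T l HT); reflexivity.
Qed.

End Relations.

(** * Quantitative lower bounds from gaps in the spectrum *)

Section SpectralGap.
Context {X : HilbertSpace}.
Implicit Types (T : rel X) (x y z w f g : X).

(* If [d] is the best constant with [d |x| <= |T x|] and both [d] and [-d] are
   regular, then for [w -> x -> y] in [T] the vector [y - d^2 w = (T-d)(T+d)w]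
   is bounded below, whereas its square is at most [|y|^2 - d^2 |x|^2]; so [d]
   was not best possible. *)
Lemma resolvent_interval_lower_bound T c : sa T -> 0 < c ->
  (forall t, Rabs t < c -> bounded_below T (mkC t 0)) ->
  forall x f, T x f -> c * norm x <= norm f.
Proof.
  intros HT Hc Hreg x0 f0 H0; apply Rnot_lt_le; intros Hlt.
  pose proof HT as [HS _].
  assert (Hx0 : 0 < norm x0) by (pose proof (norm_ge0 x0); pose proof (norm_ge0 f0); nra).
  set (E := fun e => forall x f, T x f -> e * norm x <= norm f).
  assert (Hbb0 : bounded_below T (mkC 0 0)) by (apply Hreg; rewrite Rabs_R0; exact Hc).
  pose proof Hbb0 as (c0 & Hc0 & Hb0).
  assert (Ec0 : E c0).
  { intros x f Hx; specialize (Hb0 x f Hx).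
    replace (f [-] vscal (mkC 0 0) x) with f in Hb0 by vec; exact Hb0. }
  destruct (completeness E) as [d [Hd1 Hd2]].
  { exists c; intros e He; specialize (He x0 f0 H0); nra. }
  { exists c0; exact Ec0. }
  assert (Hd : 0 < d) by (specialize (Hd1 c0 Ec0); lra).
  assert (Ed : E d).
  { intros x f Hx; apply Rnot_lt_le; intros Hl; pose proof (norm_ge0 f).
    assert (Hx' : 0 < norm x) by (pose proof (norm_ge0 x); nra).
    enough (d <= norm f / norm x).
    { apply Rmult_le_compat_r with (r := norm x) in H1; [|lra].
      unfold Rdiv in H1; rewrite Rmult_assoc, Rinv_l, Rmult_1_r in H1; lra. }
    apply Hd2; intros e He; specialize (He x f Hx).
    apply Rmult_le_reg_r with (norm x); [exact Hx'|].
    unfold Rdiv; rewrite Rmult_assoc, Rinv_l, Rmult_1_r; lra. }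
  assert (Hdc : d < c) by (specialize (Ed x0 f0 H0); nra).
  destruct (Hreg d) as (c1 & Hc1 & Hb1); [rewrite Rabs_pos_eq; lra|].
  destruct (Hreg (- d)) as (c2 & Hc2 & Hb2); [rewrite Rabs_Ropp, Rabs_pos_eq; lra|].
  set (kap := c1 * c2); assert (Hkap : 0 < kap) by (unfold kap; nra).
  (* With [r = y - d^2 w], the bounds [d |x| <= |y| <= |r| + d^2 |w|] and [kap |w| <= |r|] combine
     to [k |x| <= |r|]. *)
  set (k := d / (1 + d * d / kap)).
  assert (Hden : 0 < d * d / kap) by (apply Rdiv_lt_0_compat; nra).
  assert (Hk : 0 < k) by (unfold k; apply Rdiv_lt_0_compat; lra).
  assert (Ebig : E (sqrt (d * d + k * k))).
  { intros x y Hy.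
    destruct (sa_range_full T _ HT Hbb0 x) as (w & x' & Hw & Ex).
    replace (x' [-] vscal (mkC 0 0) w) with x' in Ex by vec; subst x'.
    pose proof (Hb2 _ _ Hw) as K2.
    replace (x [-] vscal (mkC (- d) 0) w) with (x [+] d [*] w) in K2 by vec.
    pose proof (rel_add T _ _ _ _ HS Hy (rel_rs T d _ _ HS Hw)) as Hs.
    pose proof (Hb1 _ _ Hs) as K1.
    replace (y [+] d [*] x [-] vscal (mkC d 0) (x [+] d [*] w))
      with (y [-] (d * d) [*] w) in K1 by vec.
    set (r := y [-] (d * d) [*] w) in *.
    assert (K3 : kap * norm w <= norm r) by (unfold kap; pose proof (norm_ge0 w); nra).
    pose proof (Ed _ _ Hw) as Kw; pose proof (Ed _ _ Hy) as Ky.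
    assert (K4 : norm y <= norm r + d * d * norm w).
    { eapply Rle_trans; [apply (norm_le_sub y ((d * d) [*] w))|].
      rewrite norm_rs, Rabs_pos_eq by nra; apply Rle_refl. }
    assert (K5 : k * norm x <= norm r).
    { unfold k; apply Rmult_le_reg_l with (1 + d * d / kap); [lra|].
      replace ((1 + d * d / kap) * (d / (1 + d * d / kap) * norm x)) with (d * norm x)
        by (field; split; nra).
      assert (d * d * norm w <= d * d / kap * norm r).
      { apply Rmult_le_compat_l with (r := d * d / kap) in K3; [|lra].
        replace (d * d / kap * (kap * norm w)) with (d * d * norm w) in K3 by (field; lra).
        exact K3. }
      lra. }
    (* Symmetry along [w -> x -> y] gives [<y, w> = |x|^2], and [d |w| <= |x|] bounds the remaining
       term [d^4 |w|^2] by [d^2 |x|^2]. *)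
    assert (K6 : ri r r <= ri y y - d * d * ri x x).
    { pose proof (sa_symmetric T HT _ _ _ _ Hw Hy) as Hsym.
      unfold r; autorewrite with ri_both; rewrite (ri_sym w y), Hsym.
      rewrite <- (norm_sqr x), <- (norm_sqr w).
      pose proof (norm_ge0 w); pose proof (norm_ge0 x).
      assert (Hwx : d * norm w * (d * norm w) <= norm x * norm x)
        by (apply Rmult_le_compat; nra).
      apply Rmult_le_compat_l with (r := d * d) in Hwx; [|nra].
      lra. }
    apply norm_ge.
    replace (sqrt (d * d + k * k) * norm x * (sqrt (d * d + k * k) * norm x))
      with (sqrt (d * d + k * k) * sqrt (d * d + k * k) * (norm x * norm x)) by ring.
    rewrite sqrt_sqrt, norm_sqr by nra.
    rewrite <- norm_sqr in K6; pose proof (norm_ge0 x).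
    assert (k * norm x * (k * norm x) <= norm r * norm r)
      by (apply Rmult_le_compat; nra).
    pose proof (norm_sqr x); nra. }
  specialize (Hd1 _ Ebig).
  assert (sqrt (d * d + k * k) * sqrt (d * d + k * k) = d * d + k * k) by (apply sqrt_sqrt; nra).
  pose proof (sqrt_pos (d * d + k * k)); nra.
Qed.

(* A gap on both sides of [0] gives [T^2 >= del T] and [T^2 >= - del T] as
   forms; testing them on [x2 + del x1] and [x2 - del x1] with [x2 = T x1] and
   adding yields [|T x2| >= del |x2|]. *)
Lemma gap_on_range T del x1 x2 x3 : sa T -> 0 < del ->
  (forall t, 0 < Rabs t < del -> bounded_below T (mkC t 0)) ->
  T x1 x2 -> T x2 x3 -> del * norm x2 <= norm x3.
Proof.
  intros HT Hdel Hreg H12 H23; pose proof HT as [HS _].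
  (* The interval of radius [del / 2] around [s] is regular, as it reaches 0 only at an endpoint.
     The preceding lemma thus bounds [(T - s) w] below by [|s| |w|], and in the expanded square the
     terms [s^2 |w|^2] cancel. *)
  assert (Hform : forall s w g, Rabs s = del / 2 -> T w g -> 2 * s * ri g w <= ri g g).
  { intros s w g Hs Hw.
    assert (K : del / 2 * norm w <= norm (g [-] s [*] w)).
    { apply (resolvent_interval_lower_bound (shift s T) (del / 2)).
      - apply shift_sa, HT.
      - lra.
      - intros t Ht; apply shift_bounded_below, Hreg; split.
        + apply Rabs_pos_lt; intros E; replace t with (- s) in Ht by lra.
          rewrite Rabs_Ropp in Ht; lra.
        + eapply Rle_lt_trans; [apply Rabs_triang|]; lra.
      - unfold shift; replace (g [-] s [*] w [+] s [*] w) with g by vec; exact Hw. }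
    pose proof (norm_ge0 w) as Hw0.
    assert (K2 : del / 2 * norm w * (del / 2 * norm w)
      <= norm (g [-] s [*] w) * norm (g [-] s [*] w)) by (apply Rmult_le_compat; nra).
    rewrite norm_sqr in K2; autorewrite with ri_both in K2; rewrite (ri_sym w g) in K2.
    pose proof (norm_sqr w); pose proof (Rsqr_abs s) as E; unfold Rsqr in E; rewrite Hs in E.
    nra. }
  pose proof (Hform (- (del / 2)) _ _ ltac:(rewrite Rabs_Ropp, Rabs_pos_eq; lra)
    (rel_sub T _ _ _ _ HS H23 (rel_rs T del _ _ HS H12))) as F1.
  pose proof (Hform (del / 2) _ _ ltac:(rewrite Rabs_pos_eq; lra)
    (rel_add T _ _ _ _ HS H23 (rel_rs T del _ _ HS H12))) as F2.
  pose proof (sa_symmetric T HT _ _ _ _ H12 H23) as Hsym.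
  apply norm_ge.
  replace (del * norm x2 * (del * norm x2)) with (del * del * (norm x2 * norm x2)) by ring.
  rewrite norm_sqr; autorewrite with ri_both in F1, F2.
  rewrite (ri_sym x2 x3) in F1, F2; nra.
Qed.

(** A vector orthogonal to the kernel lies in the closure [M] of the range, where [gap_on_range]
    applies. Approximating [y] alone is not enough, since its image must also be approximated;
    applying the resolvent at a regular point to approximants of [z - m y] controls both. *)
Lemma gap_off_kernel T del y z : sa T -> 0 < del ->
  (forall t, 0 < Rabs t < del -> bounded_below T (mkC t 0)) ->
  T y z -> (forall n, T n vzero -> ri y n = 0) -> del * norm y <= norm z.
Proof.
  intros HT Hdel Hreg Hyz Hker; pose proof HT as [HS _].
  set (M := fun w : X => forall e, 0 < e -> exists a b, T a b /\ norm (b [-] w) < e).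
  assert (HM : real_subspace M).
  { split; [|split].
    - intros e He; exists vzero, vzero; split; [apply HS|].
      replace (vzero [-] vzero) with (vzero : X) by vec; rewrite norm_zero; exact He.
    - intros w1 w2 H1 H2 e He; destruct (H1 (e / 2)) as (a & b & Hab & K); [lra|].
      destruct (H2 (e / 2)) as (a' & b' & Hab' & K'); [lra|].
      exists (a [+] a'), (b [+] b'); split; [apply rel_add; assumption|].
      replace (b [+] b' [-] (w1 [+] w2)) with ((b [-] w1) [+] (b' [-] w2)) by vec.
      eapply Rle_lt_trans; [apply norm_triangle|]; lra.
    - intros t w H e He; pose proof (Rabs_pos t).
      destruct (H (e / (Rabs t + 1))) as (a & b & Hab & K); [apply Rdiv_lt_0_compat; lra|].
      exists (t [*] a), (t [*] b); split; [apply rel_rs; assumption|].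
      replace (t [*] b [-] t [*] w) with (t [*] (b [-] w)) by vec; rewrite norm_rs.
      pose proof (norm_ge0 (b [-] w)).
      assert (E : (Rabs t + 1) * (e / (Rabs t + 1)) = e) by (field; lra); nra. }
  assert (Hy : M y).
  { destruct (projection M y) as (q & Hq & Ho); [exact HM| |].
    - intros u l Hu Hl e He; destruct (Hl (e / 2)) as [N HN]; [lra|].
      destruct (Hu N (e / 2)) as (a & b & Hab & K); [lra|].
      exists a, b; split; [exact Hab|]; specialize (HN N (Nat.le_refl N)).
      eapply Rle_lt_trans; [apply (norm_triangle3 b (u N) l)|]; lra.
    (* The remainder [y - q] is orthogonal to the range, so it lies in the kernel by maximality; it
       is then orthogonal to [y] and to [q], hence zero. *)
    - assert (Hr : T (y [-] q) vzero).
      { apply sa_maximal; [exact HT|]; intros a b Hab; rewrite ri_zero_l, Ho; [easy|].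
        intros e He; exists a, b; split; [exact Hab|].
        replace (b [-] b) with (vzero : X) by vec; rewrite norm_zero; exact He. }
      apply Hker in Hr; pose proof (Ho q Hq) as Hrq.
      assert (E : y = q).
      { apply vadd_opp_eq, ri_def; change (ri (y [-] q) (y [-] q) = 0).
        rewrite ri_sub_r, (ri_sym _ y), Hr, Hrq; ring. }
      rewrite E; exact Hq. }
  set (m := del / 2).
  assert (Hm : bounded_below T (mkC m 0)).
  { apply Hreg; unfold m; rewrite Rabs_pos_eq; lra. }
  pose proof Hm as (c & Hc & Hbc).
  assert (Hzy : M (z [-] m [*] y)).
  { apply real_subspace_sub; [exact HM| |apply HM, Hy].
    intros e He; exists y, z; split; [exact Hyz|].
    replace (z [-] z) with (vzero : X) by vec; rewrite norm_zero; exact He. }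
  apply le_epsilon; intros eta Heta.
  assert (Hq : 0 < (m + del) / c) by (apply Rdiv_lt_0_compat; unfold m; lra).
  (* The errors will add up to [e + m e / c + del e / c]; this choice of [e] makes the sum equal to
     [eta]. *)
  destruct (Hzy (eta / (1 + (m + del) / c))) as (a & b & Hab & K);
    [apply Rdiv_lt_0_compat; lra|].
  set (e := eta / (1 + (m + del) / c)) in *.
  assert (Ee : e * (1 + (m + del) / c) = eta) by (unfold e; field; unfold m; split; lra).
  (* The resolvent at [m] commutes with [T]: it maps [a -> b] to [cc -> u]. *)
  destruct (sa_range_full T _ HT Hm a) as (cc & fc & Hfc & Ea).
  set (u := fc).
  assert (Hu : T u (b [+] m [*] u)).
  { replace u with (a [+] vscal (mkC m 0) cc) by (unfold u; rewrite Ea; vec).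
    replace (b [+] m [*] (a [+] vscal (mkC m 0) cc)) with (b [+] vscal (mkC m 0) fc)
      by (rewrite Ea; vec).
    apply rel_add; [exact HS|exact Hab|apply rel_vscal; assumption]. }
  pose proof (gap_on_range T del _ _ _ HT Hdel Hreg Hfc Hu) as G; fold u in G.
  pose proof (Hbc _ _ (rel_sub T _ _ _ _ HS Hu Hyz)) as B.
  replace (b [+] m [*] u [-] z [-] vscal (mkC m 0) (u [-] y))
    with (b [-] (z [-] m [*] y)) in B by vec.
  assert (B1 : norm (u [-] y) <= e / c).
  { apply Rmult_le_reg_l with c; [exact Hc|].
    replace (c * (e / c)) with e by (field; lra); lra. }
  pose proof (norm_le_sub y u) as N1; rewrite (norm_sub_sym y u) in N1.
  assert (N2 : norm (b [+] m [*] u) <= norm z + norm (b [-] (z [-] m [*] y)) + m * norm (u [-] y)).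
  { replace (b [+] m [*] u) with (z [+] (b [-] (z [-] m [*] y)) [+] m [*] (u [-] y)) by vec.
    eapply Rle_trans; [apply norm_triangle|].
    rewrite norm_rs, (Rabs_pos_eq m) by (unfold m; lra).
    apply Rplus_le_compat_r, norm_triangle. }
  assert (N3 : m * norm (u [-] y) <= m * (e / c)) by (apply Rmult_le_compat_l; unfold m; lra).
  assert (N4 : del * norm (u [-] y) <= del * (e / c)) by (apply Rmult_le_compat_l; lra).
  assert (N5 : del * norm y <= del * norm (u [-] y) + del * norm u) by nra.
  assert (Ee2 : eta = e + m * (e / c) + del * (e / c)) by (rewrite <- Ee; field; lra).
  lra.
Qed.

End SpectralGap.

(** * Sequential characterization of the essential spectrum *)

Section EssentialSpectrum.
Context {X : HilbertSpace}.
Implicit Types (T : rel X) (x y f g : X).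

(** For closed [T] this is the semi-Fredholm property: the kernel of [T - l] has finite dimension
    and its range is closed. *)
Definition proper_at T (l : Cx) : Prop := forall (x f : nat -> X) (M : R) (k : X),
  (forall n, T (x n) (f n)) -> (forall n, norm (x n) <= M) ->
  converges (fun n => f n [-] vscal l (x n)) k -> has_limit_point x.

Lemma infinite_multiplicity_eigenvalue T l : infinite_multiplicity X T l -> eigenvalue X T l.
Proof.
  intros H; destruct (H 1%nat) as (v & Hv & Hi); exists (v 0%nat); split; [|apply Hv; lia].
  intros E; specialize (Hi (fun _ => C1)); simpl in Hi; rewrite E in Hi.
  assert (E1 : C1 = C0) by (apply (Hi ltac:(vec) 0%nat); lia).
  injection E1; lra.
Qed.

Lemma eigenspace_subspace T l : is_subspace X T ->
  T vzero (vscal l vzero) /\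
  (forall x y, T x (vscal l x) -> T y (vscal l y) -> T (x [+] y) (vscal l (x [+] y))) /\
  (forall a x, T x (vscal l x) -> T (vscal a x) (vscal l (vscal a x))).
Proof.
  intros HT; split; [|split].
  - replace (vscal l vzero) with (vzero : X) by vec; apply HT.
  - intros x y Hx Hy; rewrite vscal_distr_v; apply rel_add; assumption.
  - intros a x Hx; replace (vscal l (vscal a x)) with (vscal a (vscal l x)) by vec.
    apply rel_vscal; assumption.
Qed.

Lemma not_ess_spectrum_proper T l : sa T -> ~ ess_spectrum X T l -> proper_at T l.
Proof.
  intros HT Hess x f M k Hx HM Hk; pose proof HT as [HS _].
  set (y := fun n => f n [-] vscal l (x n)) in *.
  assert (Hdiff : forall n m, T (x n [-] x m) (f n [-] f m)).
  { intros n m; apply rel_sub; auto. }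
  destruct (classic (bounded_below T l)) as [(c & Hc & Hb)|Hnb].
  - destruct (cauchy_conv x) as [x0 Hx0].
    { apply cauchy_dominated with (K := / c) (v := y) (w := y);
        [|eapply converges_cauchy, Hk..].
      intros n m; pose proof (Hb _ _ (Hdiff n m)) as H.
      replace (f n [-] f m [-] vscal l (x n [-] x m)) with (y n [-] y m) in H
        by (unfold y; vec).
      pose proof (norm_ge0 (y n [-] y m)); apply Rmult_le_reg_l with c; [exact Hc|].
      rewrite <- Rmult_assoc, Rinv_r, Rmult_1_l by lra; lra. }
    exists (fun n => n), x0; split; [intros n; lia|exact Hx0].
  - assert (Hreal : Im l = 0).
    { apply NNPP; intros H; apply Hnb, nonreal_bounded_below;
        [exact HS|apply sa_symmetric, HT|exact H]. }
    destruct l as [a b]; simpl in Hreal; subst b.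
    assert (Hspec : spectrum X T (mkC a 0)) by (apply spectrum_bounded_below; assumption).
    assert (Hacc : ~ accumulation_point (spectrum X T) (mkC a 0)).
    { intros H; apply Hess; split; [exact Hspec|left; exact H]. }
    assert (Hfin : ~ infinite_dim (fun u => T u (vscal (mkC a 0) u))).
    { intros H; apply Hess; split; [exact Hspec|right].
      assert (Hinf : infinite_multiplicity X T (mkC a 0))
        by (intros n; apply (infinite_dim_independent _ H)).
      split; [apply infinite_multiplicity_eigenvalue, Hinf|split; assumption]. }
    apply not_all_ex_not in Hacc; destruct Hacc as [del Hdel].
    apply imply_to_and in Hdel; destruct Hdel as [Hdel Hno].
    set (T0 := shift a T).
    assert (HT0 : sa T0) by apply shift_sa, HT.
    assert (Hreg : forall t, 0 < Rabs t < del -> bounded_below T0 (mkC t 0)).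
    { intros t [Ht1 Ht2]; apply shift_bounded_below, NNPP; intros H; apply Hno.
      exists (mkC (a + t) 0); split; [apply spectrum_bounded_below; assumption|split].
      - intros E; injection E; intros E1; replace t with 0 in Ht1 by lra.
        rewrite Rabs_R0 in Ht1; lra.
      - unfold Cmod, Csub, Cadd, Copp; simpl.
        replace ((a + t + - a) * (a + t + - a) + (0 + -0) * (0 + -0)) with (Rsqr t)
          by (unfold Rsqr; ring).
        rewrite sqrt_Rsqr_abs; exact Ht2. }
    set (N := fun u => T0 u vzero).
    assert (HN : forall u, N u <-> T u (vscal (mkC a 0) u)).
    { intros u; unfold N, T0, shift.
      replace (vzero [+] a [*] u) with (vscal (mkC a 0) u) by vec; reflexivity. }
    assert (HNs : real_subspace N).
    { destruct HT0 as [HS0 _]; split; [apply HS0|split].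
      - intros u v Hu Hv; unfold N; replace (vzero : X) with (vzero [+] vzero : X) by vec.
        apply rel_add; assumption.
      - intros t u Hu; unfold N; replace (vzero : X) with (t [*] vzero : X) by vec.
        apply rel_rs; assumption. }
    assert (HNc : closed_set N).
    { intros u v Hu Huv; apply (sa_closed T0 HT0) with u (fun _ => vzero);
        [exact Hu|exact Huv|apply converges_const]. }
    (* Splitting off the kernel component [p n]: the differences [x n - p n] converge by the gap,
       and [p] has a limit point because the kernel has finite dimension. *)
    assert (Hex : forall n, exists p, N p /\ forall v, N v -> ri (x n [-] p) v = 0).
    { intros n; apply projection; assumption. }
    apply choice in Hex; destruct Hex as [p Hp].
    assert (Hy : forall n, T0 (x n) (y n)).
    { intros n; unfold T0, shift, y.
      replace (f n [-] vscal (mkC a 0) (x n) [+] a [*] x n) with (f n) by vec; auto. }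
    assert (Hq : conv (fun n => x n [-] p n)).
    { apply cauchy_conv, cauchy_dominated with (K := / del) (v := y) (w := y);
        [|eapply converges_cauchy, Hk..].
      intros n m.
      assert (H : del * norm (x n [-] p n [-] (x m [-] p m)) <= norm (y n [-] y m)).
      { apply (gap_off_kernel T0); [exact HT0|exact Hdel|exact Hreg| |].
        - replace (y n [-] y m) with ((y n [-] vzero) [-] (y m [-] vzero)) by vec.
          destruct HT0 as [HS0 _].
          repeat (apply rel_sub; [exact HS0| |]); try apply Hy; apply Hp.
        - intros v Hv; rewrite ri_sub_l; destruct (Hp n) as [_ ->]; [|exact Hv].
          destruct (Hp m) as [_ ->]; [ring|exact Hv]. }
      pose proof (norm_ge0 (y n [-] y m)); apply Rmult_le_reg_l with del; [exact Hdel|].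
      rewrite <- Rmult_assoc, Rinv_r, Rmult_1_l by lra; lra. }
    destruct Hq as [q Hq].
    apply not_all_ex_not in Hfin; destruct Hfin as [es Hes].
    destruct (finite_dim_compact es N HNs) with (p := p) (M := M) as (phi & p0 & Hphi & Hp0).
    { intros u Hu Hue; apply NNPP; intros Hne; apply Hes; exists u; split; [|easy].
      apply HN, Hu. }
    { intros n; apply Hp. }
    (* Orthogonality gives [|p n|^2 = <x n, p n>], so the projection does not increase the norm. *)
    { intros n; destruct (Hp n) as [Hpn Ho]; specialize (Ho _ Hpn); rewrite ri_sub_l in Ho.
      pose proof (ri_le (x n) (p n)); pose proof (norm_sqr (p n)).
      pose proof (norm_ge0 (p n)); pose proof (norm_ge0 (x n)); specialize (HM n).
      destruct (Rle_lt_dec (norm (p n)) 0); nra. }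
    exists phi, (q [+] p0); split; [exact Hphi|].
    eapply converges_ext; [|apply converges_add;
      [apply (converges_subseq _ _ phi Hphi Hq)|exact Hp0]].
    intros n; simpl; vec.
Qed.

(** Unit approximate eigenvectors at spectral points [t n] tending to 0 fast enough are almost
    orthogonal. With errors at most [|t n| / 8] and each [|t|] below half of the preceding one,
    symmetry gives [|<x n, x m>| <= 3 / 8], so distinct vectors stay at distance at least 1. *)
Lemma accumulation_not_proper T a : sa T ->
  accumulation_point (spectrum X T) (mkC a 0) -> ~ proper_at T (mkC a 0).
Proof.
  intros HT Hacc Hprop; pose proof HT as [HS _].
  set (T0 := shift a T).
  assert (HT0 : sa T0) by apply shift_sa, HT.
  assert (Hex : forall e : R, exists q : R * (X * X), 0 < e ->
    let '(t, (x, f)) := q in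
    0 < Rabs t < e /\ T0 x f /\ norm x = 1 /\ norm (f [-] t [*] x) <= Rabs t / 8).
  (* For nonpositive [e] a dummy value keeps the choice function total. *)
  { intros e; destruct (Rlt_dec 0 e) as [He|He]; [|exists (0, (vzero, vzero)); easy].
    destruct (Hacc e He) as ([m1 m2] & Hm & Hne & Hlt).
    rewrite spectrum_bounded_below in Hm by exact HT.
    assert (m2 = 0).
    { apply NNPP; intros H; apply Hm, nonreal_bounded_below;
        [exact HS|apply sa_symmetric, HT|exact H]. }
    subst m2; set (t := m1 - a).
    assert (Ht : 0 < Rabs t).
    { apply Rabs_pos_lt; intros E; apply Hne; unfold t in E; f_equal; lra. }
    unfold Cmod, Csub, Cadd, Copp in Hlt; simpl in Hlt.
    replace ((m1 + - a) * (m1 + - a) + (0 + -0) * (0 + -0)) with (Rsqr t) in Hlt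
      by (unfold Rsqr, t; ring).
    rewrite sqrt_Rsqr_abs in Hlt.
    assert (Hxf : exists x f, T x f /\ norm (f [-] vscal (mkC m1 0) x) < Rabs t / 8 * norm x).
    { apply NNPP; intros H; apply Hm; exists (Rabs t / 8); split; [lra|]; intros x f Hx.
      apply Rnot_lt_le; intros Hl; apply H; eauto. }
    destruct Hxf as (x & f & Hx & Hsmall).
    assert (Hpos : 0 < norm x).
    { pose proof (norm_ge0 x); pose proof (norm_ge0 (f [-] vscal (mkC m1 0) x)); nra. }
    exists (t, (/ norm x [*] x, / norm x [*] (f [-] a [*] x))); intros _.
    split; [split; assumption|split; [|split]].
    - apply rel_rs; [apply HT0|]; unfold T0, shift.
      replace (f [-] a [*] x [+] a [*] x) with f by vec; exact Hx.
    - rewrite norm_rs, Rabs_pos_eq; [field; lra|left; apply Rinv_0_lt_compat, Hpos].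
    - replace (/ norm x [*] (f [-] a [*] x) [-] t [*] (/ norm x [*] x))
        with (/ norm x [*] (f [-] vscal (mkC m1 0) x)) by (unfold t; vec).
      rewrite norm_rs, Rabs_pos_eq; [|left; apply Rinv_0_lt_compat, Hpos].
      apply Rmult_le_reg_l with (norm x); [exact Hpos|].
      rewrite <- Rmult_assoc, Rinv_r, Rmult_1_l by lra; lra. }
  apply choice in Hex; destruct Hex as [pick Hpick].
  set (e := fix e (n : nat) : R := match n with
    | O => 1 | S k => Rabs (fst (pick (e k))) / 2 end).
  set (t := fun n => fst (pick (e n))).
  set (x := fun n => fst (snd (pick (e n)))).
  set (f := fun n => snd (snd (pick (e n)))).
  assert (HP : forall n, 0 < e n -> 0 < Rabs (t n) < e n /\ T0 (x n) (f n) /\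
    norm (x n) = 1 /\ norm (f n [-] t n [*] x n) <= Rabs (t n) / 8).
  { intros n Hn; specialize (Hpick (e n) Hn); unfold t, x, f.
    destruct (pick (e n)) as [t' [x' f']]; exact Hpick. }
  assert (He : forall n, 0 < e n).
  { induction n as [|n IH]; [simpl; lra|]; specialize (HP n IH).
    change (0 < Rabs (t n) / 2); lra. }
  assert (HS' : forall n, e (S n) = Rabs (t n) / 2) by reflexivity.
  assert (Hle : forall n, e n <= / (INR n + 1)).
  { induction n as [|n IH]; [simpl; lra|]; rewrite HS', S_INR.
    destruct (HP n (He n)) as [[_ H] _]; pose proof (pos_INR n).
    apply Rle_trans with (/ (INR n + 1) / 2); [lra|].
    apply Rmult_le_reg_l with ((INR n + 1) * (INR n + 1 + 1)); [nra|].
    replace ((INR n + 1) * (INR n + 1 + 1) * (/ (INR n + 1) / 2)) with ((INR n + 1 + 1) / 2)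
      by (field; lra).
    replace ((INR n + 1) * (INR n + 1 + 1) * / (INR n + 1 + 1)) with (INR n + 1)
      by (field; lra).
    lra. }
  assert (Hdec : forall n m, (n < m)%nat -> e m <= Rabs (t n) / 2).
  { intros n m Hnm; induction Hnm as [|m Hnm IH]; [rewrite HS'; lra|].
    rewrite HS'; destruct (HP m (He m)) as [[_ H] _]; pose proof (He m); lra. }
  apply (separated_no_limit_point x).
  - intros n m Hnm; specialize (Hdec n m Hnm).
    destruct (HP n (He n)) as ([Hn1 Hn2] & Tn & Nn & An).
    destruct (HP m (He m)) as ([Hm1 Hm2] & Tm & Nm & Am).
    pose proof (sa_symmetric T0 HT0 _ _ _ _ Tn Tm) as Hsym.
    set (r := ri (x n) (x m)).
    (* The usual proof that eigenvectors for distinct eigenvalues are orthogonal, with the two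
       residuals kept as errors. *)
    assert (E : (t n - t m) * r
      = ri (x n) (f m [-] t m [*] x m) - ri (f n [-] t n [*] x n) (x m)).
    { unfold r; autorewrite with ri_both.
      rewrite (ri_sym (x n) (f m)), Hsym, (ri_sym (f n)); ring. }
    pose proof (cauchy_schwarz (x n) (f m [-] t m [*] x m)) as C1'.
    pose proof (cauchy_schwarz (f n [-] t n [*] x n) (x m)) as C2'.
    rewrite Nn, Rmult_1_l in C1'; rewrite Nm, Rmult_1_r in C2'.
    assert (Hr : Rabs (t n - t m) * Rabs r <= Rabs (t n) * 3 / 16).
    { rewrite <- Rabs_mult, E; eapply Rle_trans; [apply Rabs_triang|].
      rewrite Rabs_Ropp; lra. }
    assert (Ht : Rabs (t n) / 2 <= Rabs (t n - t m)).
    { pose proof (Rabs_triang_inv (t n) (t m)); lra. }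
    pose proof (Rabs_pos r).
    assert (Hr2 : Rabs r <= 3 / 8) by nra.
    apply norm_ge; autorewrite with ri_both; rewrite (ri_sym (x m) (x n)); fold r.
    rewrite <- !norm_sqr, Nn, Nm; pose proof (Rle_abs r); lra.
  - apply (Hprop x (fun n => f n [+] a [*] x n) 1 vzero).
    + intros n; apply (HP n (He n)).
    + intros n; destruct (HP n (He n)) as (_ & _ & -> & _); lra.
    + intros eps Heps; destruct (inv_S_small (eps / 2)) as [N HN]; [lra|].
      exists N; intros n Hn; specialize (HN n Hn); specialize (Hle n).
      destruct (HP n (He n)) as ([Hn1 Hn2] & Tn & Nn & An).
      replace (f n [+] a [*] x n [-] vscal (mkC a 0) (x n) [-] vzero) with (f n) by vec.
      pose proof (norm_le_sub (f n) (t n [*] x n)) as H; rewrite norm_rs, Nn in H; lra.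
Qed.

(** Normalized orthogonal eigenvectors form a bounded sequence annihilated by [T - l], with mutual
    distances [sqrt 2]. *)
Lemma infinite_multiplicity_not_proper T l : is_subspace X T ->
  infinite_multiplicity X T l -> ~ proper_at T l.
Proof.
  intros HS Hinf Hprop; destruct (eigenspace_subspace T l HS) as (N0 & Nadd & Ns).
  destruct (infinite_dim_orthogonal_seq (fun u => T u (vscal l u))) as (v & Hv & Ho).
  { apply independent_infinite_dim; assumption. }
  set (x := fun n => / norm (v n) [*] v n).
  assert (Hpos : forall n, 0 < norm (v n)).
  { intros n; destruct (Rle_lt_dec (norm (v n)) 0) as [H|H]; [|exact H].
    exfalso; apply (Hv n), norm_eq0, H. }
  assert (Hn : forall n, norm (x n) = 1).
  { intros n; unfold x; rewrite norm_rs, Rabs_pos_eq;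
      [field; specialize (Hpos n); lra|left; apply Rinv_0_lt_compat, Hpos]. }
  apply (separated_no_limit_point x).
  - intros n m Hnm; apply norm_ge; autorewrite with ri_both.
    assert (E : ri (x m) (x n) = 0).
    { unfold x; autorewrite with ri_both; destruct (Ho n m Hnm) as [-> _]; ring. }
    rewrite (ri_sym (x n) (x m)), E, <- !norm_sqr, !Hn; lra.
  - apply (Hprop x (fun n => vscal l (x n)) 1 vzero).
    + intros n; apply Ns, Hv.
    + intros n; rewrite Hn; lra.
    + apply converges_ext with (fun _ => vzero); [intros n; vec|apply converges_const].
Qed.

Lemma ess_spectrum_proper T l : sa T -> ess_spectrum X T l <-> ~ proper_at T l.
Proof.
  intros HT; split.
  - intros (Hs & [Hacc|(_ & _ & Hinf)]).
    + assert (Hreal : Im l = 0).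
      { apply NNPP; intros H; apply spectrum_bounded_below in Hs; [|exact HT].
        apply Hs, nonreal_bounded_below; [apply HT|apply sa_symmetric, HT|exact H]. }
      destruct l as [a b]; simpl in Hreal; subst b; apply accumulation_not_proper; assumption.
    + apply infinite_multiplicity_not_proper; [apply HT|exact Hinf].
  - intros H; apply NNPP; intros He; apply H, not_ess_spectrum_proper; assumption.
Qed.

End EssentialSpectrum.

(** * The operator part of a closed relation *)

Section OperatorPart.
Context {X : HilbertSpace}.
Implicit Types (T : rel X) (x y f g : X).

Lemma rel_s_char T x f : is_subspace X T ->
  rel_s X T x f <-> T x f /\ forall g, T vzero g -> ri f g = 0.
Proof.
  intros HT; unfold rel_s, rel_inf, inner2; split.
  - intros [Hx H]; split; [exact Hx|]; intros g Hg.
    specialize (H vzero g (conj eq_refl Hg)); apply (f_equal Re) in H; simpl in H.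
    change (ri x vzero + ri f g = 0) in H; rewrite ri_zero_r in H; lra.
  - intros [Hx H]; split; [exact Hx|]; intros y g [-> Hg].
    assert (HJ : T vzero (J g)).
    { replace (vzero : X) with (J vzero : X) by vec.
      unfold J; apply rel_vscal; assumption. }
    rewrite !inner_ri, (H g Hg), (H _ HJ), ri_zero_r.
    replace (J vzero : X) with (vzero : X) by vec; rewrite ri_zero_r.
    apply Cx_eq; simpl; ring.
Qed.

(** Subtracting the projection of [f] onto [T(0)] stays in [T] and does not increase the norm. The
    norm bound is what lets compactness relative to [S_s] act on arbitrary pairs of [S]. *)
Lemma rel_s_exists T x f : is_subspace X T -> rel_closed X T -> T x f ->
  exists s, rel_s X T x s /\ norm s <= norm f.
Proof.
  intros HT Hcl Hx.
  destruct (projection (fun g => T vzero g) f) as (p & Hp & Ho).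
  - split; [apply HT|split].
    + intros g h Hg Hh; replace (vzero : X) with (vzero [+] vzero : X) by vec.
      apply rel_add; assumption.
    + intros t g Hg; replace (vzero : X) with (t [*] vzero : X) by vec.
      apply rel_rs; assumption.
  - intros u l Hu Hl; apply Hcl with (fun _ => vzero) u;
      [exact Hu|apply converges_const|exact Hl].
  - exists (f [-] p); split.
    + apply rel_s_char; [exact HT|]; split; [|exact Ho].
      replace x with (x [-] vzero) by vec; apply rel_sub; assumption.
    + specialize (Ho p Hp); apply norm_le; [apply norm_ge0|]; rewrite norm_sqr.
      rewrite ri_sub_r, (ri_sym _ p), (ri_sym p), Ho, ri_sub_l.
      rewrite ri_sub_l in Ho; pose proof (ri_pos p); rewrite (ri_sym p f); lra.
Qed.

Lemma rel_s_subspace T : is_subspace X T -> is_subspace X (rel_s X T).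
Proof.
  intros HT; split; [|split].
  - apply rel_s_char; [exact HT|]; split; [apply HT|]; intros g _; apply ri_zero_l.
  - intros x f y g Hx Hy; apply rel_s_char in Hx, Hy; try exact HT.
    destruct Hx as [Hx Ox]; destruct Hy as [Hy Oy].
    apply rel_s_char; [exact HT|]; split; [apply rel_add; assumption|].
    intros k Hk; rewrite ri_add_l, Ox, Oy by exact Hk; ring.
  - intros a x f Hx; apply rel_s_char in Hx; try exact HT; destruct Hx as [Hx Ox].
    apply rel_s_char; [exact HT|]; split; [apply rel_vscal; assumption|].
    intros k Hk; rewrite ri_vscal_l, (Ox k Hk), (Ox (J k)); [ring|].
    replace (vzero : X) with (J vzero : X) by vec; unfold J; apply rel_vscal; assumption.
Qed.

Lemma rel_s_closed T : is_subspace X T -> rel_closed X T -> rel_closed X (rel_s X T).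
Proof.
  intros HT Hcl x f x0 f0 Hn Hx Hf; apply rel_s_char; [exact HT|]; split.
  - apply Hcl with x f; [intros n; apply Hn|exact Hx|exact Hf].
  - intros g Hg; eapply UL_sequence; [apply converges_ri, Hf|].
    intros e He; exists 0%nat; intros n _.
    specialize (Hn n); apply rel_s_char in Hn; [|exact HT]; destruct Hn as [_ ->]; [|exact Hg].
    unfold Rdist; rewrite Rminus_diag, Rabs_R0; exact He.
Qed.

Lemma rel_s_single T g : is_subspace X T -> rel_s X T vzero g -> g = vzero.
Proof. intros HT H; apply rel_s_char in H; [|exact HT]; apply ri_def, H, H. Qed.

End OperatorPart.

(** * Relatively compact perturbations and transfer of properness *)

Section CompactPerturbation.
Context {X : HilbertSpace}.
Implicit Types (S G T A : rel X) (x y f g h : X).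

(** The interface between the hypotheses and the perturbation argument, with [T = S + G].
    Compactness is stated for [S] itself, so the operator part of [S] no longer appears. *)
Record compact_perturbation S G T : Prop := {
  cp_subspace : is_subspace X G;
  cp_closed : rel_closed X G;
  cp_single : forall g, G vzero g -> g = vzero;
  cp_symmetric : symmetric G;
  cp_dom : forall x f, S x f -> exists g, G x g;
  cp_sum : forall x h, T x h <-> exists f g, S x f /\ G x g /\ h = f [+] g;
  cp_compact : forall (x f g : nat -> X) (M : R),
    (forall n, S (x n) (f n)) -> (forall n, G (x n) (g n)) ->
    (forall n, norm (x n) <= M) -> (forall n, norm (f n) <= M) -> has_limit_point g }.

(** A failure for every constant yields pairs of graph norm 1 with [eps |f n| + n |x n| < |g n|].
    Along a subsequence [g] converges, so [x] tends to 0 and closedness of [G] forces the limit of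
    [g] to be 0; but [|f n|] tends to 1, which keeps [|g n|] away from 0. *)
Lemma relative_bound S G T eps : sa S -> compact_perturbation S G T -> 0 < eps ->
  exists C, 0 <= C /\ forall x f g, S x f -> G x g -> norm g <= eps * norm f + C * norm x.
Proof.
  intros HS HP Heps; apply NNPP; intros Hno.
  assert (Hex : forall n : nat, exists q : X * (X * X),
    let '(x, (f, g)) := q in S x f /\ G x g /\ norm x + norm f = 1 /\
      eps * norm f + INR n * norm x < norm g).
  { intros n.
    assert (H : exists x f g, S x f /\ G x g /\ eps * norm f + INR n * norm x < norm g).
    { apply NNPP; intros H; apply Hno; exists (INR n); split; [apply pos_INR|].
      intros x f g Hf Hg; apply Rnot_lt_le; intros Hl; apply H; eauto 6. }
    destruct H as (x & f & g & Hf & Hg & Hl).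
    set (N := norm x + norm f).
    assert (HN : 0 < N).
    { pose proof (norm_ge0 x) as H1; pose proof (norm_ge0 f) as H2.
      apply Rnot_le_lt; intros H3; unfold N in H3.
      assert (Ex : x = vzero) by (apply norm_eq0; lra).
      rewrite Ex in Hg; apply (cp_single _ _ _ HP) in Hg; subst x g.
      rewrite norm_zero in *; pose proof (pos_INR n); nra. }
    assert (HiN : 0 < / N) by (apply Rinv_0_lt_compat, HN).
    exists (/ N [*] x, (/ N [*] f, / N [*] g)); split; [|split; [|split]].
    - apply rel_rs; [apply HS|exact Hf].
    - apply rel_rs; [apply (cp_subspace _ _ _ HP)|exact Hg].
    - rewrite !norm_rs, Rabs_pos_eq by lra.
      replace (/ N * norm x + / N * norm f) with (/ N * N) by (unfold N; ring).
      field; lra.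
    - rewrite !norm_rs, Rabs_pos_eq by lra.
      apply Rmult_lt_compat_l with (r := / N) in Hl; [lra|exact HiN]. }
  apply choice in Hex; destruct Hex as [q Hq].
  set (x := fun n => fst (q n)); set (f := fun n => fst (snd (q n))).
  set (g := fun n => snd (snd (q n))).
  assert (HQ : forall n, S (x n) (f n) /\ G (x n) (g n) /\ norm (x n) + norm (f n) = 1 /\
    eps * norm (f n) + INR n * norm (x n) < norm (g n)).
  { intros n; specialize (Hq n); unfold x, f, g.
    destruct (q n) as [x' [f' g']]; exact Hq. }
  destruct (cp_compact _ _ _ HP x f g 1) as (phi & g0 & Hphi & Hg0); try (intros n; apply HQ).
  { intros n; destruct (HQ n) as (_ & _ & H & _); pose proof (norm_ge0 (f n)); lra. }
  { intros n; destruct (HQ n) as (_ & _ & H & _); pose proof (norm_ge0 (x n)); lra. }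
  destruct (converges_bounded _ _ Hg0) as [M HM].
  assert (HM0 : 0 <= M) by (pose proof (norm_ge0 (g (phi 0%nat))); specialize (HM 0%nat); lra).
  assert (Hx0 : converges (fun n => x (phi n)) vzero).
  { intros e He; destruct (inv_S_small (e / (M + 1))) as [N HN]; [apply Rdiv_lt_0_compat; lra|].
    (* Index [n + 1] is used because [phi (n + 1) >= n + 1] matches the denominator in
       [inv_S_small]. *)
    exists (Datatypes.S N); intros [|n] Hn; [lia|].
    replace (x (phi (Datatypes.S n)) [-] vzero) with (x (phi (Datatypes.S n))) by vec.
    set (k := phi (Datatypes.S n)); destruct (HQ k) as (_ & _ & _ & H).
    specialize (HM (Datatypes.S n)); fold k in HM; specialize (HN n ltac:(lia)).
    assert (Hk : INR n + 1 <= INR k).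
    { rewrite <- S_INR; apply le_INR, (subseq_ge phi Hphi (Datatypes.S n)). }
    pose proof (norm_ge0 (x k)); pose proof (norm_ge0 (f k)); pose proof (pos_INR n).
    assert (Hb : (INR n + 1) * norm (x k) <= M) by nra.
    apply Rmult_lt_compat_l with (r := M + 1) in HN; [|lra].
    replace ((M + 1) * (e / (M + 1))) with e in HN by (field; lra).
    apply Rle_lt_trans with ((M + 1) * / (INR n + 1)); [|exact HN].
    apply Rmult_le_reg_l with (INR n + 1); [lra|].
    replace ((INR n + 1) * ((M + 1) * / (INR n + 1))) with (M + 1) by (field; lra); lra. }
  assert (E0 : g0 = vzero).
  { apply (cp_single _ _ _ HP), (cp_closed _ _ _ HP) with (fun n => x (phi n)) (fun n => g (phi n));
      [intros n; apply HQ|exact Hx0|exact Hg0]. }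
  subst g0.
  destruct (Hx0 (1 / 2)) as [N1 H1]; [lra|]; destruct (Hg0 (eps / 2)) as [N2 H2]; [lra|].
  set (n := Nat.max N1 N2); specialize (H1 n ltac:(lia)); specialize (H2 n ltac:(lia)).
  simpl in H1, H2.
  replace (x (phi n) [-] vzero) with (x (phi n)) in H1 by vec.
  replace (g (phi n) [-] vzero) with (g (phi n)) in H2 by vec.
  destruct (HQ (phi n)) as (_ & _ & E & H); pose proof (pos_INR (phi n)).
  pose proof (norm_ge0 (x (phi n))); nra.
Qed.

Lemma perturbation_sub S G T x h g : sa S -> compact_perturbation S G T ->
  T x h -> G x g -> S x (h [-] g).
Proof.
  intros HS HP HT Hg; apply (cp_sum _ _ _ HP) in HT; destruct HT as (f & g' & Hf & Hg' & ->).
  assert (E : g' = g).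
  { apply vadd_opp_eq, (cp_single _ _ _ HP).
    replace (vzero : X) with (x [-] x) by vec.
    apply rel_sub; [apply (cp_subspace _ _ _ HP)| |]; assumption. }
  subst g'; replace (f [+] g [-] g) with f by vec; exact Hf.
Qed.

Lemma perturbation_dom S G T x h : compact_perturbation S G T -> T x h -> exists g, G x g.
Proof. intros HP H; apply (cp_sum _ _ _ HP) in H; destruct H as (f & g & _ & Hg & _); eauto. Qed.

(** Since [f = h - g], a relative bound [1 / 2] lets the resulting [|g| / 2] be absorbed on the
    left. *)
Lemma relative_bound_sum S G T : sa S -> compact_perturbation S G T ->
  exists C, 0 <= C /\ forall x h g, T x h -> G x g -> norm g <= norm h + C * norm x.
Proof.
  intros HS HP; destruct (relative_bound S G T (1 / 2) HS HP) as (C & HC & H); [lra|].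
  exists (2 * C); split; [lra|]; intros x h g Hh Hg.
  specialize (H x _ g (perturbation_sub S G T x h g HS HP Hh Hg) Hg).
  pose proof (norm_sub_le h g); lra.
Qed.

Lemma perturbation_subspace S G T : sa S -> compact_perturbation S G T -> is_subspace X T.
Proof.
  intros [HS _] HP; pose proof (cp_subspace _ _ _ HP) as HG; split; [|split].
  - apply (cp_sum _ _ _ HP); exists vzero, vzero; split; [apply HS|split; [apply HG|vec]].
  - intros x h y k Hh Hk; apply (cp_sum _ _ _ HP) in Hh, Hk.
    destruct Hh as (f & g & Hf & Hg & ->); destruct Hk as (f' & g' & Hf' & Hg' & ->).
    apply (cp_sum _ _ _ HP); exists (f [+] f'), (g [+] g').
    split; [apply rel_add; assumption|split; [apply rel_add; assumption|vec]].
  - intros a x h Hh; apply (cp_sum _ _ _ HP) in Hh; destruct Hh as (f & g & Hf & Hg & ->).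
    apply (cp_sum _ _ _ HP); exists (vscal a f), (vscal a g).
    split; [apply rel_vscal; assumption|split; [apply rel_vscal; assumption|vec]].
Qed.

Lemma perturbation_symmetric S G T : sa S -> compact_perturbation S G T -> symmetric T.
Proof.
  intros HS HP x h y k Hh Hk; apply (cp_sum _ _ _ HP) in Hh, Hk.
  destruct Hh as (f & g & Hf & Hg & ->); destruct Hk as (f' & g' & Hf' & Hg' & ->).
  rewrite ri_add_l, ri_add_r.
  rewrite (sa_symmetric S HS _ _ _ _ Hf Hf'), (cp_symmetric _ _ _ HP _ _ _ _ Hg Hg').
  reflexivity.
Qed.

(** The bound by the graph norm of [T] makes the values of [G] Cauchy, so closedness can be applied
    to [S] and [G] separately. *)
Lemma perturbation_closed S G T : sa S -> compact_perturbation S G T -> rel_closed X T.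
Proof.
  intros HS HP x h x0 h0 Hn Hx Hh.
  assert (Hex : forall n, exists g, G (x n) g) by (intros n; eapply perturbation_dom; eauto).
  apply choice in Hex; destruct Hex as [g Hg].
  destruct (relative_bound_sum S G T HS HP) as (C & HC & HB).
  destruct (cauchy_conv g) as [g0 Hg0].
  { apply cauchy_dominated with (K := 1 + C) (v := h) (w := x);
      [|eapply converges_cauchy; eassumption..].
    intros n m; specialize (HB (x n [-] x m) (h n [-] h m) (g n [-] g m)).
    pose proof (norm_ge0 (x n [-] x m)); pose proof (norm_ge0 (h n [-] h m)).
    enough (norm (g n [-] g m) <= norm (h n [-] h m) + C * norm (x n [-] x m)) by nra.
    apply HB; apply rel_sub; auto; [eapply perturbation_subspace; eassumption|].
    apply (cp_subspace _ _ _ HP). }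
  apply (cp_sum _ _ _ HP); exists (h0 [-] g0), g0; split; [|split; [|vec]].
  - apply (sa_closed S HS) with x (fun n => h n [-] g n).
    + intros n; eapply perturbation_sub; eauto.
    + exact Hx.
    + apply converges_sub; assumption.
  - apply (cp_closed _ _ _ HP) with x g; assumption.
Qed.

(* A vector [r = (S - i mu) x] orthogonal to [(T - i mu) x = r + G x] vanishes
   once [|G x| <= |r| / 2]. *)
Lemma perturbation_range_full S G T : sa S -> compact_perturbation S G T ->
  exists mu0, 0 < mu0 /\ forall mu, Rabs mu = mu0 ->
  forall y, exists x h, T x h /\ y = h [-] vscal (mkC 0 mu) x.
Proof.
  intros HS HP; destruct (relative_bound S G T (1 / 4) HS HP) as (C & HC & HB); [lra|].
  (* From [|mu| |x| <= |r|] this gives [C |x| <= |r| / 4], and [|f| <= |r|] accounts for the other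
     quarter of [|r|]; the summand 1 keeps [mu] nonzero when [C = 0]. *)
  exists (4 * C + 1); split; [lra|]; intros mu Hmu.
  pose proof (perturbation_subspace S G T HS HP) as HTs.
  pose proof (perturbation_symmetric S G T HS HP) as HTsym.
  assert (Hmu0 : mu <> 0) by (intros ->; rewrite Rabs_R0 in Hmu; lra).
  apply range_full; [exact HTs|eapply perturbation_closed; eassumption| |].
  { apply nonreal_bounded_below; assumption. }
  intros r Hr; pose proof HS as [HSs _].
  destruct (sa_range_full S (mkC 0 mu) HS) with (y := r) as (x & f & Hf & Er).
  { apply nonreal_bounded_below; [exact HSs|apply sa_symmetric, HS|exact Hmu0]. }
  destruct (cp_dom _ _ _ HP x f Hf) as [g Hg].
  assert (H0 : ri r (r [+] g) = 0).
  { replace (r [+] g) with (f [+] g [-] vscal (mkC 0 mu) x) by (rewrite Er; vec).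
    apply Hr, (cp_sum _ _ _ HP); eauto. }
  pose proof (symmetric_lower_bound S (mkC 0 mu) x f HSs (sa_symmetric S HS) Hf) as L1.
  pose proof (symmetric_sub_vscal S (mkC 0 mu) x f HSs (sa_symmetric S HS) Hf) as L2.
  rewrite <- Er in L1, L2; simpl in L1, L2; rewrite Hmu in L1.
  replace (f [-] 0 [*] x) with f in L2 by vec.
  assert (L3 : norm f <= norm r).
  { apply norm_ge; rewrite norm_sqr; pose proof (ri_pos x); nra. }
  specialize (HB x f g Hf Hg).
  pose proof (norm_ge0 x); pose proof (norm_ge0 r).
  assert (Hgr : norm g <= norm r / 2) by nra.
  rewrite ri_add_r, <- norm_sqr in H0.
  pose proof (cauchy_schwarz r g) as CS; pose proof (Rle_abs (- ri r g)) as RA.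
  rewrite Rabs_Ropp in RA; apply norm_eq0; nra.
Qed.

(** Given [(y, g)] in the adjoint, solve [(T - i mu) x = g - i mu y] inside [T]. The difference
    [u = y - x] is then orthogonal to the range of [T + i mu], which is all of [X]; this is why both
    signs of [mu] are needed. *)
Lemma perturbation_sa S G T : sa S -> compact_perturbation S G T -> sa T.
Proof.
  intros HS HP; pose proof (perturbation_subspace S G T HS HP) as HTs.
  apply sa_intro; [exact HTs|eapply perturbation_symmetric; eassumption|].
  destruct (perturbation_range_full S G T HS HP) as (mu & Hmu & Hfull).
  intros y g Hadj.
  destruct (Hfull mu ltac:(apply Rabs_pos_eq; lra) (g [-] vscal (mkC 0 mu) y))
    as (x & h & Hx & E).
  set (u := y [-] x).
  assert (Eu : g [-] h = vscal (mkC 0 mu) u).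
  { transitivity (g [-] vscal (mkC 0 mu) y [+] vscal (mkC 0 mu) y [-] h); [vec|].
    rewrite E; unfold u; vec. }
  assert (Hu : u = vzero).
  { destruct (Hfull (- mu) ltac:(rewrite Rabs_Ropp; apply Rabs_pos_eq; lra) u)
      as (a & b & Hab & Eab).
    apply ri_def; rewrite Eab at 2; rewrite ri_sub_r, (ri_sym u (vscal _ a)), ri_vscal_l.
    assert (K : ri (g [-] h) a = ri u b).
    { unfold u; rewrite !ri_sub_l, (Hadj a b Hab).
      rewrite (perturbation_symmetric S G T HS HP _ _ _ _ Hab Hx); reflexivity. }
    rewrite Eu, ri_vscal_l in K; simpl in *.
    rewrite <- (ri_sym (J u)), ri_J_l; lra. }
  assert (Ey : y = x) by (apply vadd_opp_eq; exact Hu).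
  assert (Eg : g = h).
  { apply vadd_opp_eq; change (g [-] h = vzero); rewrite Eu, Hu; vec. }
  subst y g; exact Hx.
Qed.

(** Boundedness of [x] and convergence of [f - l x] bound [f], so the correction [g] converges along
    a subsequence and [f + g - l x] converges there too. Stated for an abstract correction, it
    serves both directions, with [G] and with [- G]. *)
Lemma proper_transfer S T l :
  (forall (x f : nat -> X) M, (forall n, S (x n) (f n)) ->
    (forall n, norm (x n) <= M) -> (forall n, norm (f n) <= M) ->
    exists g : nat -> X, (forall n, T (x n) (f n [+] g n)) /\ has_limit_point g) ->
  proper_at T l -> proper_at S l.
Proof.
  intros H HT x f M k Hf HM Hk.
  destruct (converges_bounded _ _ Hk) as [M' HM'].
  set (c := Rabs (Re l) + Rabs (Im l)).
  assert (Hc : 0 <= c) by (pose proof (Rabs_pos (Re l)); pose proof (Rabs_pos (Im l)); unfold c; lra).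
  destruct (H x f (Rmax M (M' + c * M)) Hf) as (g & Hg & phi & g0 & Hphi & Hg0).
  { intros n; eapply Rle_trans; [apply HM|apply Rmax_l]. }
  { intros n; eapply Rle_trans; [|apply Rmax_r].
    pose proof (norm_le_sub (f n) (vscal l (x n))); pose proof (norm_vscal_le l (x n)).
    specialize (HM n); specialize (HM' n); fold c in H1; simpl in HM'; nra. }
  apply has_limit_point_subseq with phi; [exact Hphi|].
  apply (HT _ (fun n => f (phi n) [+] g (phi n)) M (k [+] g0)).
  - intros n; apply Hg.
  - intros n; apply HM.
  - eapply converges_ext; [|apply converges_add;
      [apply (converges_subseq _ _ phi Hphi Hk)|exact Hg0]].
    intros n; simpl; vec.
Qed.

Lemma perturbation_proper S G T l : sa S -> compact_perturbation S G T ->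
  proper_at S l <-> proper_at T l.
Proof.
  intros HS HP; split; apply proper_transfer; intros x f M Hf Hx HM.
  - assert (Hex : forall n, exists g, G (x n) g) by (intros n; eapply perturbation_dom; eauto).
    apply choice in Hex; destruct Hex as [g Hg].
    destruct (relative_bound_sum S G T HS HP) as (C & HC & HB).
    assert (HS' : forall n, S (x n) (f n [-] g n)) by (intros n; eapply perturbation_sub; eauto).
    assert (HM0 : 0 <= M) by (pose proof (norm_ge0 (x 0%nat)); specialize (Hx 0%nat); lra).
    (* Here [f] takes values in [T]; [|g| <= M + C M] bounds the values [f - g] of [S] by
       [2 M + C M]. *)
    destruct (cp_compact _ _ _ HP x (fun n => f n [-] g n) g (2 * M + C * M))
      as (phi & g0 & Hphi & Hg0); [exact HS'|exact Hg| | |].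
    { intros n; specialize (Hx n); nra. }
    { intros n; pose proof (norm_sub_le (f n) (g n)); specialize (HB _ _ _ (Hf n) (Hg n)).
      specialize (Hx n); specialize (HM n); nra. }
    exists (fun n => vopp (g n)); split; [exact HS'|].
    exists phi, (vopp g0); split; [exact Hphi|apply converges_opp, Hg0].
  - assert (Hex : forall n, exists g, G (x n) g) by (intros n; eapply (cp_dom _ _ _ HP); eauto).
    apply choice in Hex; destruct Hex as [g Hg]; exists g; split.
    + intros n; apply (cp_sum _ _ _ HP); eauto.
    + apply (cp_compact _ _ _ HP) with x f M; assumption.
Qed.

Lemma operator_part_perturbation S A : sa S ->
  is_subspace X A -> rel_closed X A -> hermitian X A ->
  (forall x, dom X S x -> dom X A x) ->
  rel_compact_wrt X (rel_s X A) (rel_s X S) ->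
  compact_perturbation S (rel_s X A) (rel_sum X S A).
Proof.
  intros HS HA Acl Aher Hdom [_ Hcomp]; pose proof (hermitian_symmetric A Aher) as Asym.
  assert (Hex : forall x f, S x f -> exists g, rel_s X A x g).
  { intros x f Hf; destruct (Hdom x (ex_intro _ f Hf)) as [a Ha].
    destruct (rel_s_exists A x a HA Acl Ha) as (g & Hg & _); eauto. }
  (* For [g] in [A(0)] and [x] in [D(S)], hence in [D(A)], symmetry of [A] gives [<g, x> = 0]; so
     [(0, g)] is in the adjoint of [S]. *)
  assert (Hmul : forall g, A vzero g -> S vzero g).
  { intros g Hg; apply sa_maximal; [exact HS|]; intros x f Hf.
    destruct (Hdom x (ex_intro _ f Hf)) as [a Ha].
    rewrite (Asym _ _ _ _ Ha Hg), !ri_zero_l; reflexivity. }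
  split.
  - apply rel_s_subspace, HA.
  - apply rel_s_closed; assumption.
  - intros g; apply rel_s_single, HA.
  - intros x f y g [Hf _] [Hg _]; apply Asym; assumption.
  - exact Hex.
  - intros x h; split.
    + intros (f & a & Hf & Ha & ->); destruct (Hex x f Hf) as [g Hg].
      (* The multivalued part [a - g] of the value of [A] is absorbed into [S(0)]. *)
      exists (f [+] (a [-] g)), g; split; [|split; [exact Hg|vec]].
      replace x with (x [+] vzero) by vec; apply rel_add; [apply HS|exact Hf|].
      apply Hmul; replace (vzero : X) with (x [-] x) by vec.
      apply rel_sub; [exact HA|exact Ha|apply Hg].
    + intros (f & g & Hf & [Hg _] & ->); exists f, g; auto.
  - intros x f g M Hf Hg Hx HM.
    assert (Hs : forall n, exists s, rel_s X S (x n) s /\ norm s <= norm (f n)).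
    { intros n; apply rel_s_exists; [apply HS|apply sa_closed, HS|apply Hf]. }
    apply choice in Hs; destruct Hs as [s Hs].
    apply (Hcomp x s g (M + M)); [intros n; apply Hs|exact Hg|].
    intros n; destruct (Hs n) as [_ H]; specialize (Hx n); specialize (HM n); lra.
Qed.

End CompactPerturbation.

Theorem theorem5p2 (X : HilbertSpace) (S A : rel X) :
  is_subspace X S -> selfadjoint X S ->
  is_subspace X A -> rel_closed X A -> hermitian X A ->
  (forall x, dom X S x -> dom X A x) ->
  rel_compact_wrt X (rel_s X A) (rel_s X S) ->
  (forall l : Cx, ess_spectrum X S l <-> ess_spectrum X (rel_sum X S A) l) /\
  ((forall l : Cx, ~ ess_spectrum X S l) <-> (forall l : Cx, ~ ess_spectrum X (rel_sum X S A) l)).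
Proof.
  intros HS1 HS2 HA Acl Aher Hdom Hcomp.
  assert (HS : sa S) by (split; assumption).
  pose proof (operator_part_perturbation S A HS HA Acl Aher Hdom Hcomp) as HP.
  pose proof (perturbation_sa _ _ _ HS HP) as HT.
  assert (Heq : forall l : Cx, ess_spectrum X S l <-> ess_spectrum X (rel_sum X S A) l).
  { intros l; rewrite (ess_spectrum_proper S l HS), (ess_spectrum_proper _ l HT).
    rewrite (perturbation_proper _ _ _ l HS HP); reflexivity. }
  split; [exact Heq|].
  split; intros H l Hl; apply (H l), Heq, Hl.
Qed.
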